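(* In the abelian case, the map $w\mapsto\Gamma_w:=\min(\Delta(1)\setminus N(w))$ is a bijection from $W^0$ onto the set $\mathrm{AN}(\Delta(1))$ of antichains of $\Delta(1)$. Furthermore, for $w\in W^0$: (i) $I_w:=\Delta(1)\setminus N(w)$ is an upper ideal of $\Delta(1)$; (ii) for $\gamma\in I_w$, $\gamma\in\min(I_w)$ if and only if $w(\gamma)\in\Pi$; i.e. $\Gamma_w=\min(I_w)=w^{-1}(\Pi)\cap\Delta(1)$; (iii) for $\gamma\in N(w)$, $\gamma\in\max(N(w))$ if and only if $w(\gamma)\in-\Pi$; i.e. $\max(N(w))=\max(\Delta(1)\setminus I_w)=-w^{-1}(\Pi)\cap\Delta(1)$. In particular, $\#\mathrm{AN}(\Delta(1))=\#(W/W(0))$ and $\#I_w=\dim\mathfrak g(1)-\ell(w)$.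
   Context: Let $\mathfrak g$ be a complex simple Lie algebra with Cartan subalgebra $\mathfrak t$, root system $\Delta$, positive roots $\Delta^+$, simple roots $\Pi$, Weyl group $W$ with length function $\ell$, and highest root $\theta$. For $\gamma\in\Delta$ and $\alpha\in\Pi$, $[\gamma:\alpha]$ is the coefficient of $\alpha$ in $\gamma$. Abelian case: fix $\alpha_i\in\Pi$ with $[\theta:\alpha_i]=1$, and put $\Delta(j)=\{\gamma\in\Delta:[\gamma:\alpha_i]=j\}$, so $\Delta=\Delta(-1)\sqcup\Delta(0)\sqcup\Delta(1)$ and $\Delta^+=\Delta(0)^+\sqcup\Delta(1)$ with $\Delta(0)^+=\Delta(0)\cap\Delta^+$. Let $\mathfrak g(1)$ be the sum of the root spaces for $\Delta(1)$ (so $\dim\mathfrak g(1)=\#\Delta(1)$). Let $\Pi(0)=\Pi\setminus\{\alpha_i\}$ and $W(0)$ the subgroup of $W$ generated by the reflections $s_\alpha$, $\alpha\in\Pi(0)$. $W^0=\{w\in W: w(\alpha)\in\Delta^+\ \forall\alpha\in\Delta(0)^+\}$ (minimal length coset representatives of $W/W(0)$). $N(w)=\{\gamma\in\Delta^+: w(\gamma)\in-\Delta^+\}$ is the inversion set. $\Delta(1)$ is partially ordered by $\mu\preccurlyeq\gamma$ iff $\gamma-\mu$ is a nonnegative integer combination of $\Pi(0)$. An upper ideal $I$ of a poset satisfies $x\in I,\ x\preccurlyeq y\Rightarrow y\in I$; $\min(M)$, $\max(M)$ denote the sets of minimal/maximal elements of $M$. *)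

(* Defs.v *)
From HB Require Import structures.
From mathcomp Require Import all_boot all_order all_algebra.
From mathcomp Require Import finmap.
From mathcomp Require Import mathcomp_extra boolp classical_sets functions.
From mathcomp Require Import cardinality fsbigop reals.
From mathcomp Require Export complex.

Set Implicit Arguments.
Unset Strict Implicit.
Unset Printing Implicit Defensive.

Import Order.TTheory GRing.Theory Num.Theory.
Local Open Scope classical_set_scope.
Local Open Scope ring_scope.

HB.mixin Record Vector_isLieAlgebra (K : fieldType) g of Vector K g := {
  lie : g -> g -> g;
  lie_linearl : forall y, linear (fun x => lie x y);
  lie_linearr : forall x, linear (lie x);
  liexx : forall x, lie x x = 0;
  lie_jacobi : forall x y z,
    lie x (lie y z) + lie y (lie z x) + lie z (lie x y) = 0 }.

(* finite-dimensional, since a Vector is *)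
#[short(type="lieAlgType")]
HB.structure Definition LieAlgebra (K : fieldType) :=
  { g of Vector K g & Vector_isLieAlgebra K g }.

Section LieAlgebras.
Context (K : fieldType) (g : lieAlgType K).
Implicit Types (x y : g) (U t : {vspace g}).

HB.instance Definition _ x :=
  GRing.isLinear.Build K g g _ (lie x) (lie_linearr x).

Definition ad x : 'End(g) := linfun (lie x).

Lemma adE x y : ad x y = lie x y.
Proof. by rewrite lfunE. Qed.

Definition lie_ideal U := forall x y, y \in U -> lie x y \in U.

Definition simple_lie :=
  (exists x y, lie x y != 0) /\
  (forall U, lie_ideal U -> U = 0%VS \/ U = fullv).

Definition diagonalizable_end (f : 'End(g)) :=
  exists2 X : seq g, basis_of fullv X & {in X, forall x, exists a, f x = a *: x}.

(* Cartan subalgebras of a semisimple Lie algebra: abelian, self-centralizing,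
   and acting on g by diagonalizable endomorphisms. *)
Definition cartan_subalgebra t :=
  [/\ {in t &, forall x y, lie x y = 0},
      (forall x, {in t, forall h, lie h x = 0} -> x \in t) &
      {in t, forall h, diagonalizable_end (ad h)}].

End LieAlgebras.

Arguments simple_lie {K} g.

Notation dual_space t := 'Hom(subvs_of t, _^o).

Section Roots.
Context (K : fieldType) (g : lieAlgType K) (t : {vspace g}).
Implicit Types (a b l : dual_space t) (A B : set (dual_space t)).

Local Notation ad_shift h c := (ad h - (c : K) *: \1%VF)%R.

(* {x | [h, x] = l(h) x for all h in t}, see rootspaceP; it is enough to let h
   range over a basis of t. *)
Definition rootspace l : {vspace g} :=
  (\bigcap_(h <- vbasis (fullv : {vspace subvs_of t}))
     lker (ad_shift (vsval h) (l h)))%VS.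

Lemma rootspaceP l x :
  reflect (forall h, lie (vsval h) x = (l h : K) *: x) (x \in rootspace l).
Proof.
have kerE h : (x \in lker (ad_shift (vsval h) (l h))) =
    (lie (vsval h) x == (l h : K) *: x).
  by rewrite memv_ker add_lfunE opp_lfunE scale_lfunE id_lfunE adE subr_eq0.
rewrite /rootspace; apply: (iffP idP) => [xl h | xl]; last first.
  apply: (big_ind (fun U : {vspace g} => x \in U)) => [|U V xU xV|h _].
  - exact: memvf.
  - by rewrite memv_cap xU.
  - by rewrite kerE xl.
have {}xl k : k \in (vbasis (fullv : {vspace subvs_of t}) : seq _) ->
    lie (vsval k) x = (l k : K) *: x.
  move=> kb; apply/eqP; rewrite -kerE.
  by move: xl; rewrite (big_rem k) //= memv_cap => /andP[].
rewrite (coord_vbasis (memvf h)) !linear_sum /= scaler_suml.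
pose D := GRing.isLinear.Build K g g _ (fun z => lie z x) (lie_linearl x).
pose f : {linear g -> g} := HB.pack (fun z : g => lie z x) D.
rewrite [LHS](linear_sum f); apply: eq_bigr => i _.
have fZ c z : lie (c *: z) x = c *: lie z x := linearZZ f c z.
rewrite [f _]fZ linearZ /= -scalerA -xl //.
by rewrite mem_nth // size_tuple.
Qed.

Definition is_root a : bool := (a != 0) && (rootspace a != 0%VS).

(* The h of an sl_2-triple (e, h, f) with e in g_a and f in g_(-a); it is
   unique when a is a root of a semisimple Lie algebra. *)
Definition coroot a : subvs_of t :=
  xget 0 [set h | a h = 2 /\
    exists e f,
      [/\ e \in rootspace a, f \in rootspace (- a) & lie e f = vsval h]].

Definition refl a : 'End(dual_space t) :=
  linfun (fun l : dual_space t => l - (l (coroot a) : K) *: a).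

Lemma reflE a l : refl a l = l - (l (coroot a) : K) *: a.
Proof.
have lin : linear (fun l : dual_space t => l - (l (coroot a) : K) *: a).
  move=> c u v; rewrite add_lfunE scale_lfunE scalerDl opprD scalerBr scalerA.
  by rewrite addrACA.
pose f : {linear dual_space t -> dual_space t} :=
  HB.pack (fun l : dual_space t => l - (l (coroot a) : K) *: a)
  (GRing.isLinear.Build K (dual_space t) (dual_space t) _ _ lin).
by rewrite /refl (lfunE f).
Qed.

Definition refl_prod (s : seq (dual_space t)) : 'End(dual_space t) :=
  \big[@comp_lfun K _ _ _ / \1%VF]_(a <- s) refl a.

(* The group generated by the reflections s_a, a in A (as these are
   involutions, it consists of the products of such reflections). *)
Definition refl_group A : set 'End(dual_space t) :=
  [set w | exists2 s, {in s, forall a, A a} & w = refl_prod s].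

Definition weyl_group := refl_group [set` is_root].

Definition is_length (A : set (dual_space t)) (w : 'End(dual_space t)) (n : nat) :=
  (exists s, [/\ size s = n, {in s, forall a, A a} & w = refl_prod s]) /\
  (forall s, {in s, forall a, A a} -> w = refl_prod s -> (n <= size s)%N).

Definition left_cosets (W W' : set 'End(dual_space t)) :
    set (set 'End(dual_space t)) :=
  [set [set (w \o u)%VF | u in W'] | w in W].

End Roots.

Arguments weyl_group {K g} t.

Section SimpleRoots.
Context (K : fieldType) (g : lieAlgType K) (t : {vspace g}).
Context (n : nat) (Pi : n.-tuple (dual_space t)).
Implicit Types (a b c : dual_space t) (w : 'End(dual_space t)).

Definition nneg_comb a := exists k : 'I_n -> nat, a = \sum_(j < n) tnth Pi j *+ k j.

Definition is_base :=
  [/\ basis_of fullv Pi,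
      {in Pi, forall a, is_root a} &
      forall a, is_root a -> nneg_comb a \/ nneg_comb (- a)].

Definition positive_roots : set (dual_space t) :=
  [set a | is_root a /\ nneg_comb a].

Definition highest_root a :=
  is_root a /\ forall b, is_root b -> nneg_comb (a - b).

Definition length w : nat := xget 0%N (is_length [set` Pi] w).

Definition inversions w : set (dual_space t) :=
  [set a | positive_roots a /\ positive_roots (- w a)].

Context (i : 'I_n).

(* Delta(j) = {a | [a : alpha_i] = j}, with alpha_i the i-th simple root *)
Definition graded_roots (j : int) : set (dual_space t) :=
  [set a | is_root a /\ coord Pi i a = j%:~R].

Definition graded_part (j : int) : {vspace g} :=
  (\big[addv/0%VS]_(a \in graded_roots j) rootspace a)%VS.

Definition simple_roots0 : set (dual_space t) :=
  [set tnth Pi j | j in [set j | j != i]].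

Definition weyl_group0 := refl_group simple_roots0.

Definition min_coset_reps : set 'End(dual_space t) :=
  [set w | weyl_group t w /\
    forall a, (graded_roots 0 `&` positive_roots) a -> positive_roots (w a)].

Definition root_le a b :=
  exists k : 'I_n -> nat, b - a = \sum_(j < n | j != i) tnth Pi j *+ k j.

End SimpleRoots.

Section Posets.
Context (T : Type) (le : T -> T -> Prop).

Definition minimal (M : set T) : set T :=
  [set x | M x /\ forall y, M y -> le y x -> y = x].

Definition maximal (M : set T) : set T :=
  [set x | M x /\ forall y, M y -> le x y -> y = x].

Definition upper_ideal (P I : set T) :=
  I `<=` P /\ forall x y, I x -> P y -> le x y -> I y.

Definition antichains (P : set T) : set (set T) :=
  [set A | A `<=` P /\ forall x y, A x -> A y -> le x y -> x = y].

End Posets.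

(* Main.v *)
(* A weight basis [X_i], of weights [lam_i], diagonalizes the Cartan subalgebra;
   the trace form in this basis is invariant, and it is nondegenerate because its
   radical is an ideal: if the form were zero, all [g_a, g_(-a)] would vanish and
   the root vectors would span a proper ideal.  This yields sl_2-triples, hence unbroken
   root strings, one-dimensional root spaces and the reduced root system.

   For [w] in [W^0], a positive root [w c] is simple iff it is not a sum of two
   positive roots; applying [w^-1] to such a sum, one summand lands in
   [Delta(0)^+] and the other one is an element of [I_w] below [c], whence (ii),
   and likewise (iii).  A lower ideal [M] is the inversion set of some [w] by
   induction: remove a maximal [c] of [M], which by (ii) is mapped to a simple
   root by the [w'] with [N(w') = M \ {c}], and take [w = s_(w' c) w'].
   Injectivity holds since [w] is determined by [N(w)]. *)
From HB Require Import structures.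
Require Import Defs.
From mathcomp Require Import all_boot all_order all_algebra.
From mathcomp Require Import finmap.
From mathcomp Require Import boolp classical_sets functions cardinality reals.
From mathcomp Require Import fsbigop zify ring.

Set Implicit Arguments.
Unset Strict Implicit.
Unset Printing Implicit Defensive.

Import Order.TTheory GRing.Theory Num.Theory.
Local Open Scope classical_set_scope.
Local Open Scope card_scope.
Local Open Scope ring_scope.

(** * Weight bases *)

Section BasisCoordinates.
Context (K : fieldType) (V : vectType K) (m : nat) (X : m.-tuple V).
Context (Xb : basis_of fullv X).

(** The roots live in a space over [K] itself, with neither a real form nor an invariant inner
    product. Positivity is therefore read on the integers [a (coroot b)] and on coordinates in the
    base, compared inside [K]; [coroot_sym] does the work of a symmetric form. Since [coroot] is a
    choice among the [h] of all sl_2-triples, its equivariance under the Weyl group is not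
    immediate. [weyl_conj] extracts it from the finiteness of the root set, and the exchange
    condition rests on it. The assumption that [theta] has coefficient 1 at [alpha_i] acts through
    [graded_cases]: only the degrees -1, 0, 1 occur, so two roots of total degree 1 have degrees 0
    and 1, never 2 and -1. Hence one of the summands always falls under the sign condition that
    defines [W^0]. *)

Lemma coord_tnth j k : coord X j (tnth X k) = (j == k)%:R.
Proof. by rewrite (tnth_nth 0) coord_free ?(basis_free Xb)// eq_sym. Qed.

Lemma coord_expand x : x = \sum_j coord X j x *: tnth X j.
Proof.
rewrite {1}(coord_basis Xb (memvf x)).
by apply: eq_bigr => j _; rewrite (tnth_nth 0).
Qed.

Lemma coord_inj x y : (forall j, coord X j x = coord X j y) -> x = y.
Proof.
by move=> xy; rewrite (coord_expand x) (coord_expand y); apply: eq_bigr => j _; rewrite xy.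
Qed.

End BasisCoordinates.

Section SimultaneousDiagonalization.
Import passmx.
Context (K : fieldType) (g : lieAlgType K).
Let e := vbasis (fullv : {vspace g}).
Let eP : basis_of fullv e := vbasisP fullv.

Lemma vecof_inj0 u : vecof e u = 0 -> u = 0.
Proof.
by move=> /(congr1 (rVof e)); rewrite vecofK ?(basis_free eP)// linear0.
Qed.

Lemma diagonalizable_mxof (f : 'End(g)) :
  diagonalizable_end f -> diagonalizable (mxof e e f).
Proof.
move=> [Y Yb Yf].
have sY : size Y == \dim (fullv : {vspace g}).
  by rewrite -(@size_basis _ _ fullv _ (in_tuple Y)).
pose X := Tuple sY; have Xb : basis_of fullv X by [].
pose P := mxof X e \1.
have PU : P \in unitmx.
  rewrite -row_free_unit; apply: inj_row_free => v.
  rewrite mul_mxof id_lfunE => /(congr1 (vecof e)).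
  rewrite rVofK// linear0 => /(congr1 (rVof X)).
  by rewrite vecofK ?(basis_free Xb)// linear0.
exists P => //; apply/similar_diagPex.
have /choice[d dP] (i : 'I_(\dim (fullv : {vspace g}))) :
    exists a, f X`_i = a *: X`_i.
  by apply: Yf; rewrite mem_nth // size_tuple.
exists (\row_i d i); apply/similarP => //.
apply/row_matrixP => i.
rewrite !row_mul row_diag_mx mxE -scalemxAl -!rowE.
rewrite !rowE !mul_mxof !vecof_delta !id_lfunE.
by rewrite rVofK ?dP ?linearZ.
Qed.

(** Reduces to simultaneous diagonalization of matrices: the rows of the diagonalizing matrix [P]
    are the coordinates, in a fixed basis, of the common eigenvectors. *)
Lemma common_eigenbasis (fs : seq 'End(g)) :
  {in fs &, forall f h, (f \o h = h \o f)%VF} ->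
  {in fs, forall f, diagonalizable_end f} ->
  exists2 X : (\dim (fullv : {vspace g})).-tuple g, basis_of fullv X &
    forall f, f \in fs -> forall i, exists c, f (tnth X i) = c *: tnth X i.
Proof.
move=> fsC fsD; pose As := [seq mxof e e f | f <- fs].
have [|P PU /allP PD] := (codiagonalizableP As).1.
  split=> [_ _ /mapP[f ffs ->] /mapP[h hfs ->]|_ /mapP[f ffs ->]].
    by rewrite /comm_mx -!mxof_comp ?(basis_free eP)// fsC.
  exact/diagonalizable_mxof/fsD.
pose X := [tuple vecof e (row i P) | i < \dim (fullv : {vspace g})].
have Xb : basis_of fullv X.
  rewrite basisEfree subvf size_tuple leqnn !andbT; apply/freeP => k.
  under eq_bigr do rewrite -tnth_nth tnth_mktuple -linearZ.
  rewrite -linear_sum /= => /vecof_inj0 kP i.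
  have : (\row_i k i) *m P = 0.
    by rewrite mulmx_sum_row -[RHS]kP; apply: eq_bigr => j _; rewrite mxE.
  move=> /(congr1 (mulmx^~ (invmx P))); rewrite mulmxK// mul0mx.
  by move=> /matrixP/(_ 0 i); rewrite !mxE.
exists X => // f ffs i.
have /similar_diagPex[d /(similarP PU) Pd] := PD _ (map_f _ ffs).
exists (d 0 i); rewrite tnth_mktuple -linearZ /=.
have /(congr1 (vecof e)) := mul_mxof e e f (row i P).
rewrite rVofK// => <-; rewrite -row_mul Pd row_mul row_diag_mx -scalemxAl.
by rewrite -rowE.
Qed.

End SimultaneousDiagonalization.

Section LieBasics.
Context (K : fieldType) (g : lieAlgType K).
Implicit Types (x y z : g) (t : {vspace g}).

(** The bracket with its second argument fixed gets a name so that it can carry a linear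
    structure. *)
Definition lier y x := lie x y.

HB.instance Definition _ y :=
  GRing.isLinear.Build K g g _ (lier y) (lie_linearl y).

Lemma lieDl x x' y : lie (x + x') y = lie x y + lie x' y.
Proof. exact: (linearD (lier y)). Qed.

Lemma lieZl c x y : lie (c *: x) y = c *: lie x y.
Proof. exact: (linearZ_LR (lier y)). Qed.

Lemma lie0l y : lie 0 y = 0.
Proof. exact: (linear0 (lier y)). Qed.

Lemma lie_suml I (r : seq I) (P : pred I) (F : I -> g) y :
  lie (\sum_(i <- r | P i) F i) y = \sum_(i <- r | P i) lie (F i) y.
Proof. exact: (linear_sum (lier y)). Qed.

Lemma lieDr x y y' : lie x (y + y') = lie x y + lie x y'.
Proof. exact: linearD. Qed.

Lemma lieNr x y : lie x (- y) = - lie x y.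
Proof. exact: linearN. Qed.

Lemma lieZr c x y : lie x (c *: y) = c *: lie x y.
Proof. exact: linearZ_LR. Qed.

Lemma lie0r x : lie x 0 = 0.
Proof. exact: linear0. Qed.

Lemma lieC x y : lie x y = - lie y x.
Proof.
apply/eqP; rewrite -addr_eq0; apply/eqP; have := liexx (x + y).
by rewrite lieDl !lieDr !liexx add0r addr0.
Qed.

Lemma lie_lie x y z : lie (lie x y) z = lie x (lie y z) - lie y (lie x z).
Proof.
have /eqP := lie_jacobi x y z; rewrite [lie z (lie x y)]lieC addr_eq0 opprK.
by move=> /eqP <-; rewrite [lie z x]lieC lieNr.
Qed.

Lemma lier_lie x y z : lie x (lie y z) = lie (lie x y) z + lie y (lie x z).
Proof. by rewrite lie_lie subrK. Qed.

Lemma weight_basis t : cartan_subalgebra t ->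
  exists (X : (\dim (fullv : {vspace g})).-tuple g)
         (lam : 'I_(\dim (fullv : {vspace g})) -> dual_space t),
    basis_of fullv X /\
    forall i h, lie (vsval h) (tnth X i) = (lam i h : K) *: tnth X i.
Proof.
move=> [tC _ tD]; pose hs := vbasis (fullv : {vspace subvs_of t}).
have [||X Xb XE] := @common_eigenbasis K g [seq ad (vsval h) | h <- hs].
- move=> _ _ /mapP[h _ ->] /mapP[h' _ ->]; apply/lfunP => x.
  rewrite !comp_lfunE !adE lier_lie.
  by rewrite (tC (vsval h) (vsval h')) ?subvsP// lie0l add0r.
- by move=> _ /mapP[h _ ->]; apply: tD; apply: subvsP.
(* The weight is defined as the i-th coordinate of [[h, X_i]], which is linear in [h] before it is
   known to be the eigenvalue. *)
have lin i : linear (fun h : subvs_of t =>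
    coord X i (lie (vsval h) (tnth X i)) : K^o).
  by move=> c h h'; rewrite !linearP /= lieDl lieZl linearP.
pose lam i : {linear subvs_of t -> K^o} :=
  HB.pack (fun h : subvs_of t => coord X i (lie (vsval h) (tnth X i)) : K^o)
    (GRing.isLinear.Build K (subvs_of t) K^o _ _ (lin i)).
exists X, (fun i => linfun (lam i)); split=> // i h; rewrite lfunE /=.
suff [c hc] : exists c, lie (vsval h) (tnth X i) = c *: tnth X i.
  rewrite hc linearZ /= [in coord _ _ _](tnth_nth 0) coord_free;
    last exact: basis_free Xb.
  by rewrite eqxx mulr1.
rewrite (coord_vbasis (memvf h)) !linear_sum /=.
elim/big_ind: _ => [|u v [c uc] [d vd]|k _].
- by exists 0; rewrite lie0l scale0r.
- by exists (c + d); rewrite lieDl uc vd scalerDl.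
have [|c] := XE (ad (vsval hs`_k)) _ i.
  by apply: map_f; rewrite mem_nth// size_tuple.
rewrite adE => kc; exists (coord hs k h * c).
by rewrite lieZl kc scalerA.
Qed.

End LieBasics.

(** * The trace form and sl_2-triples *)

Section KillingForm.
Context (K : numFieldType) (g : lieAlgType K) (t : {vspace g}).
Context (m : nat) (X : m.-tuple g) (lam : 'I_m -> dual_space t).
Context (gS : simple_lie g) (tC : cartan_subalgebra t).
Context (Xb : basis_of fullv X).
Context (XE : forall i h, lie (vsval h) (tnth X i) = (lam i h : K) *: tnth X i).
Implicit Types (x y z : g) (a b l : dual_space t) (h : subvs_of t).

Lemma coord_eq0 x : (forall i, coord X i x = 0) -> x = 0.
Proof. by move=> x0; rewrite (coord_expand Xb x) big1// => i _; rewrite x0 scale0r. Qed.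

Lemma coord_lie_torus h x i : coord X i (lie (vsval h) x) = lam i h * coord X i x.
Proof.
rewrite {1}(coord_expand Xb x) !linear_sum /= (bigD1 i)//= big1 ?addr0 => [|j ji];
  rewrite !linearZ /= XE !linearZ /= (coord_tnth Xb).
  by rewrite eqxx mulr1 mulrC.
by rewrite eq_sym (negPf ji) !mulr0.
Qed.

Lemma memv_rootspace l x :
  x \in rootspace l <-> forall i, lam i != l -> coord X i x = 0.
Proof.
split=> [/rootspaceP xl i|xl].
  case/lfunPn => h hi; have := coord_lie_torus h x i.
  rewrite xl linearZ /= => /eqP; rewrite -subr_eq0 -mulrBl mulf_eq0 subr_eq0.
  by rewrite eq_sym (negPf hi) /= => /eqP.
apply/rootspaceP => h; apply/eqP; rewrite -subr_eq0; apply/eqP/coord_eq0 => i.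
rewrite linearB linearZ /= coord_lie_torus -mulrBl.
by have [->|/xl ->] := eqVneq (lam i) l; rewrite ?subrr ?mul0r ?mulr0.
Qed.

Lemma tnth_rootspace i : tnth X i \in rootspace (lam i).
Proof.
apply/memv_rootspace => j ij; rewrite (coord_tnth Xb).
by rewrite eq_sym; case: (eqVneq i j) ij => // ->; rewrite eqxx.
Qed.

Lemma tnth_neq0 i : tnth X i != 0.
Proof. by apply: (free_not0 (basis_free Xb)); apply: mem_tnth. Qed.

Lemma rootspace_neq0 l : rootspace l != 0%VS <-> exists i, lam i = l.
Proof.
split=> [|[i <-]]; last first.
  by apply: contra_neq (tnth_neq0 i) => l0; apply/eqP; rewrite -memv0 -l0 tnth_rootspace.
move=> l0; apply: contrapT => nl; case/negP: l0; rewrite -subv0.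
apply/subvP => x /memv_rootspace xl; rewrite memv0; apply/eqP/coord_eq0 => i.
by apply: xl; apply/eqP => il; apply: nl; exists i.
Qed.

Lemma mem_rootspace_neq0 l x : x \in rootspace l -> x != 0 -> rootspace l != 0%VS.
Proof. by move=> xl; apply: contraNneq => l0; rewrite -memv0 -l0. Qed.

Lemma lie_rootspace a b x y :
  x \in rootspace a -> y \in rootspace b -> lie x y \in rootspace (a + b).
Proof.
move=> /rootspaceP xa /rootspaceP yb; apply/rootspaceP => h.
by rewrite lier_lie xa yb lieZl lieZr -scalerDl add_lfunE.
Qed.

Lemma rootspace0 x : x \in rootspace (0 : dual_space t) <-> x \in t.
Proof.
case: tC => tA tZ _; split=> [/rootspaceP x0|xt].
  apply: tZ => h ht; have := x0 (vsproj t h).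
  by rewrite vsprojK// zero_lfunE scale0r.
by apply/rootspaceP => h; rewrite zero_lfunE scale0r tA// subvsP.
Qed.

Lemma lie_opp_rootspace a x y :
  x \in rootspace a -> y \in rootspace (- a) -> exists h, lie x y = vsval h.
Proof.
move=> xa ya; have := lie_rootspace xa ya; rewrite subrr => /rootspace0 xyt.
by exists (vsproj t (lie x y)); rewrite vsprojK.
Qed.

Lemma lie_torus_weight l x h : x \in rootspace l -> lie (vsval h) x = (l h : K) *: x.
Proof. by move/rootspaceP. Qed.

(** Such an [h] is central, so its line is an ideal; this line is not all of [g], where some bracket
    is nonzero. *)
Lemma torus_eq0 h : (forall i, lam i h = 0) -> h = 0.
Proof.
move=> h0; have hx x : lie (vsval h) x = 0.
  by apply: coord_eq0 => i; rewrite coord_lie_torus h0 mul0r.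
case: gS => -[x [y xy]] ideals.
have [|h00|hf] := ideals <[vsval h]>%VS.
- by move=> u _ /vlineP[c ->]; rewrite lieZr lieC hx oppr0 scaler0 mem0v.
- by apply: val_inj; apply/eqP; rewrite /= -memv0 -h00 memv_line.
- have /vlineP[c xE] : x \in <[vsval h]>%VS by rewrite hf memvf.
  by rewrite xE lieZl hx scaler0 eqxx in xy.
Qed.

(** When the span of the [X_i] with [i] in [S] is stable under [f], this is the trace of [f] on that
    span. *)
Definition partial_trace (S : pred 'I_m) (f : g -> g) :=
  \sum_(i | S i) coord X i (f (tnth X i)).

(** [S = predT] yields the invariance of the trace form; [S] a root string yields [bracket_eq0]. *)
Lemma partial_traceC (S : pred 'I_m) (f f' : {linear g -> g}) :
  (forall i j, S i -> ~~ S j -> coord X j (f (tnth X i)) = 0) ->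
  (forall i j, S i -> ~~ S j -> coord X j (f' (tnth X i)) = 0) ->
  partial_trace S (f \o f') = partial_trace S (f' \o f).
Proof.
have E (u v : {linear g -> g}) :
    (forall i j, S i -> ~~ S j -> coord X j (v (tnth X i)) = 0) ->
  partial_trace S (u \o v) =
  \sum_(i | S i) \sum_(j | S j) coord X j (v (tnth X i)) * coord X i (u (tnth X j)).
  move=> vS; apply: eq_bigr => i Si /=.
  rewrite {1}(coord_expand Xb (v _)) !linear_sum /= (bigID S) /=.
  rewrite [X in _ + X]big1 ?addr0 => [|j Sj]; last by rewrite vS// scale0r !linear0.
  by apply: eq_bigr => j _; rewrite !linearZ.
move=> fS f'S; rewrite !E// exchange_big /=.
by apply: eq_bigr => i _; apply: eq_bigr => j _; rewrite mulrC.
Qed.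

Definition kappa x y := partial_trace predT (lie x \o lie y).

Lemma kappaC x y : kappa x y = kappa y x.
Proof. exact: partial_traceC. Qed.

Lemma kappaDl x x' y : kappa (x + x') y = kappa x y + kappa x' y.
Proof.
by rewrite -big_split; apply: eq_bigr => i _ /=; rewrite lieDl linearD.
Qed.

Lemma kappaZl c x y : kappa (c *: x) y = c * kappa x y.
Proof.
by rewrite mulr_sumr; apply: eq_bigr => i _ /=; rewrite lieZl linearZ.
Qed.

Lemma kappa_linear x : linear (kappa x : g -> K^o).
Proof. by move=> c u v; rewrite ![kappa x _]kappaC kappaDl kappaZl. Qed.

HB.instance Definition _ x := GRing.isLinear.Build K g K^o _ (kappa x : g -> K^o)
  (kappa_linear x).

Lemma kappaZr x c y : kappa x (c *: y) = c * kappa x y.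
Proof. exact: linearZ_LR. Qed.

Lemma kappaA x y z : kappa (lie x y) z = kappa x (lie y z).
Proof.
transitivity (partial_trace predT (lie x \o (lie y \o lie z)) -
              partial_trace predT (lie y \o (lie x \o lie z))).
  by rewrite -sumrB; apply: eq_bigr => i _ /=; rewrite lie_lie linearB.
rewrite (@partial_traceC _ (lie y) (lie x \o lie z))// -sumrB.
by apply: eq_bigr => i _ /=; rewrite lie_lie !linearB.
Qed.

Lemma kappa_torus h h' : kappa (vsval h) (vsval h') = \sum_i lam i h * lam i h'.
Proof.
apply: eq_bigr => i _ /=.
by rewrite !coord_lie_torus (coord_tnth Xb) eqxx mulr1.
Qed.

Lemma kappa_rootspace a b x y :
  x \in rootspace a -> y \in rootspace b -> a + b != 0 -> kappa x y = 0.
Proof.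
move=> /rootspaceP xa /rootspaceP yb /lfunPn[h].
rewrite add_lfunE zero_lfunE => hab.
have := kappaA x (vsval h) y; rewrite lieC xa yb kappaZr -scaleNr kappaZl.
move=> /esym/eqP; rewrite -subr_eq0 -mulrBl opprK mulf_eq0 addrC.
by rewrite (negPf hab) => /eqP.
Qed.

Lemma kappa_pairing a e f h :
  e \in rootspace a -> f \in rootspace (- a) -> kappa (lie e f) (vsval h) = a h * kappa e f.
Proof.
move=> ea /rootspaceP fa; rewrite kappaA lieC fa -scaleNr kappaZr.
by rewrite opp_lfunE opprK.
Qed.

(** Pigeonhole: the basis carries at most [m] weights, while the [b + k a] are pairwise distinct in
    characteristic 0. *)
Lemma weights_along_line a b : a != 0 -> exists k, rootspace (b + a *+ k) == 0%VS.
Proof.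
move=> a0; apply: contrapT => H.
have /choice[f fE] : forall k, exists i, lam i = b + a *+ k.
  by move=> k; apply/rootspace_neq0/negP => k0; apply: H; exists k.
have f_inj : injective (fun k : 'I_m.+1 => f k).
  move=> k k' /(congr1 lam); rewrite !fE => /addrI.
  wlog kk' : k k' / (k <= k')%N.
    by move=> W; case/orP: (leq_total k k') => ? H'; [|apply/esym]; apply: W.
  move=> /esym/eqP; rewrite -subr_eq0 -mulrnBr// -scaler_nat scaler_eq0 (negPf a0).
  rewrite orbF pnatr_eq0 subn_eq0 => k'k; apply/val_inj/eqP.
  by rewrite eqn_leq kk'.
by have := leq_card _ f_inj; rewrite !card_ord ltnn.
Qed.

(* Climb with [e] from [x] to a vector [v] killed by [e], then descend with [f]
   until [f^(n+1) v = 0]: the weight of [v] at [h] is then [n]. *)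
Lemma sl2_string a b e f h x :
  e \in rootspace a -> f \in rootspace (- a) -> lie e f = vsval h -> a h = 2 ->
  x \in rootspace b -> x != 0 ->
  exists z : int, [/\ b h = z%:~R, lie e x = 0 -> 0 <= z &
    forall k : nat, k%:Z <= z -> rootspace (b - a *+ k) != 0%VS].
Proof.
move=> ea fa efh ah xb x0.
have a0 : a != 0 by apply: contra_eq_neq ah => ->; rewrite zero_lfunE eq_sym pnatr_eq0.
have Ewt k : iter k (lie e) x \in rootspace (b + a *+ k).
  elim: k => [|k IH]; first by rewrite addr0.
  by rewrite iterS mulrS addrCA lie_rootspace.
have Eex : exists k, iter k (lie e) x == 0.
  have [k /eqP k0] := weights_along_line b a0; exists k.
  by rewrite -memv0 -k0 Ewt.
case: (ex_minnP Eex) => -[|q]; first by rewrite (negPf x0).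
rewrite iterS => /eqP; set v := iter q (lie e) x => ev qmin.
have v0 : v != 0 by apply/negP => /qmin; rewrite ltnn.
set mu := b + a *+ q; have vmu : v \in rootspace mu by apply: Ewt.
have Fwt k : iter k (lie f) v \in rootspace (mu - a *+ k).
  elim: k => [|k IH]; first by rewrite subr0.
  by rewrite iterS mulrS opprD addrCA lie_rootspace.
have Frel k : lie e (iter k.+1 (lie f) v) =
    (k.+1%:R * (mu h - k%:R)) *: iter k (lie f) v.
  elim: k => [|k IH].
    by rewrite /= lier_lie efh ev lie0r addr0 subr0 mul1r (lie_torus_weight _ vmu).
  rewrite [iter k.+2 _ _]iterS lier_lie efh IH lieZr -iterS.
  rewrite (lie_torus_weight _ (Fwt k.+1)) -scalerDl; congr (_ *: _).
  rewrite add_lfunE opp_lfunE -scaler_nat scale_lfunE ah -[LHS]/((mu h - k.+1%:R * 2) + _).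
  rewrite -[k.+2]addn2 -[k.+1]addn1 !natrD; set M := mu h : K; set r := k%:R : K.
  by ring.
have Fex : exists k, iter k (lie f) v == 0.
  have ma0 : - a != 0 by rewrite oppr_eq0.
  have [k /eqP k0] := weights_along_line mu ma0; exists k.
  by rewrite -memv0 -k0 mulNrn Fwt.
case: (ex_minnP Fex) => -[|n]; first by rewrite (negPf v0).
move=> /eqP Fn nmin.
have muh : mu h = n%:R.
  have := Frel n; rewrite Fn lie0r => /esym/eqP; rewrite scaler_eq0 mulf_eq0.
  rewrite pnatr_eq0 /= subr_eq0 => /orP[/eqP//|/nmin]; by rewrite ltnn.
have bh : b h = (n%:Z - (q * 2)%:Z)%:~R.
  rewrite rmorphB /= -!pmulrn -muh /mu add_lfunE -scaler_nat scale_lfunE ah.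
  by rewrite natrM [_ *: _]/(q%:R * 2) addrK.
(* Climbing from [b] to [mu] took [q] steps of weight 2, whence [z = n - 2q]. The weight [b - k a]
   sits [q + k] steps below [mu], and [q + k <= n] as soon as [k <= z]. *)
exists (n%:Z - (q * 2)%:Z); split=> // [ex|k].
  have : (q.+1 <= 1)%N.
    rewrite leqNgt; apply/negP => q1; have := qmin 1%N.
    by rewrite /= ex eqxx leqNgt q1 => /(_ isT).
  by rewrite ltnS leqn0 => /eqP ->; rewrite subr0.
rewrite lerBrDr -PoszD lez_nat => kn.
have -> : b - a *+ k = mu - a *+ (q + k).
  by rewrite /mu mulrnDr opprD addrA addrK.
apply: mem_rootspace_neq0 (Fwt _) _; apply/negP => /nmin; apply/negP.
by rewrite -ltnNge ltnS (leq_trans _ kn)//; lia.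
Qed.

(** On the full [a]-string through [lam i], stable under [e] and [f], the trace of [[e, f]] is 0,
    while [h] acts there by the scalar [lam i h] because [a h = 0]. In characteristic 0 this forces
    [lam i h = 0], for every [i]. *)
Lemma bracket_eq0 a e f h : e \in rootspace a -> f \in rootspace (- a) ->
  lie e f = vsval h -> a h = 0 -> h = 0.
Proof.
move=> ea fa efh ah0; apply: torus_eq0 => i.
pose S : pred 'I_m := fun j => `[< exists k : int, lam j = lam i + a *~ k >].
have shift b u j k (kb : int) : b = a *~ kb -> u \in rootspace b ->
    S j -> ~~ S k -> coord X k (lie u (tnth X j)) = 0.
  move=> -> ub /asboolP[c jc] /asboolPn Sk.
  have /memv_rootspace-> // := lie_rootspace ub (tnth_rootspace j).
  apply/eqP => ki; apply: Sk; exists (kb + c).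
  by rewrite ki jc mulrzDr addrCA.
have : partial_trace S (lie e \o lie f) = partial_trace S (lie f \o lie e).
  by apply: partial_traceC => j k; [apply: (shift a _ _ _ 1)|
    apply: (shift (- a) _ _ _ (-1))]; rewrite ?mulrN1z.
move=> /eqP; rewrite -subr_eq0 -sumrB.
rewrite (eq_bigr (fun=> lam i h : K)) => [|j /asboolP[c jc]]; last first.
  rewrite /= -linearB -lie_lie efh /= coord_lie_torus (coord_tnth Xb) eqxx mulr1 jc.
  by rewrite add_lfunE -scaler_int scale_lfunE ah0 scaler0 addr0.
rewrite sumr_const -mulr_natr mulf_eq0 => /orP[/eqP//|].
rewrite pnatr_eq0 -leqn0 leqNgt => /negP[]; apply/card_gt0P; exists i.
by apply/asboolP; exists 0; rewrite addr0.
Qed.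

Section Triple.
Context (a : dual_space t) (e f : g) (h : subvs_of t).
Context (ea : e \in rootspace a) (fa : f \in rootspace (- a)).
Context (efh : lie e f = vsval h) (ah : a h = 2).

Lemma triple_neq0 : [/\ a != 0, e != 0 & f != 0].
Proof.
have a0 : a h != 0 by rewrite ah pnatr_eq0.
have h0 : h != 0 by apply: contraNneq a0 => ->; rewrite linear0.
split.
- by apply: contraNneq a0 => ->; rewrite zero_lfunE.
- apply: contraNneq h0 => e0; apply/eqP/subvs_inj.
  by rewrite -efh e0 lie0l linear0.
- apply: contraNneq h0 => f0; apply/eqP/subvs_inj.
  by rewrite -efh f0 lie0r linear0.
Qed.

Lemma triple_weight i : exists z : int, lam i h = z%:~R.
Proof.
have [z [zE _ _]] := sl2_string ea fa efh ah (tnth_rootspace i) (tnth_neq0 i).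
by exists z.
Qed.

(** A sum of squares of integers over the weights, in which the weight [a] contributes 4. *)
Lemma triple_kappa_gt0 : 0 < kappa (vsval h) (vsval h).
Proof.
have [_ e0 _] := triple_neq0.
have /rootspace_neq0[i ia] := mem_rootspace_neq0 ea e0.
rewrite kappa_torus (bigD1 i)//= ia ah ltr_wpDr//; last first.
  by rewrite [_ * _]/(2 * 2 : K) mulr_gt0.
apply: sumr_ge0 => j _; have [z ->] := triple_weight j.
have : 0 <= (z * z)%:~R :> K by rewrite ler0z; nia.
by rewrite intrM.
Qed.

Lemma triple_opp : lie f e = vsval (- h).
Proof. by rewrite lieC efh raddfN. Qed.

Lemma triple_opp_root : (- a) (- h) = 2.
Proof. by rewrite opp_lfunE linearN opprK. Qed.

End Triple.

Lemma scaled_triple a e f h : e \in rootspace a -> f \in rootspace (- a) ->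
  lie e f = vsval h -> a h != 0 ->
  exists c : K, [/\ c != 0, c *: f \in rootspace (- a),
    lie e (c *: f) = vsval (c *: h) & a (c *: h) = 2].
Proof.
move=> ea fa efh ah; exists (2 / (a h : K)); split.
- by rewrite mulf_neq0 ?invr_eq0 ?pnatr_eq0.
- exact: memvZ.
- by rewrite lieZr efh linearZ.
- by rewrite linearZ; apply: (@divfK K (a h) ah 2).
Qed.

Lemma kappa_bracket_eq0 a e f h : e \in rootspace a -> f \in rootspace (- a) ->
  lie e f = vsval h -> kappa (vsval h) (vsval h) = 0 -> h = 0.
Proof.
move=> ea fa efh kh; have [ah|ah] := eqVneq (a h : K) 0.
  exact: (bracket_eq0 ea fa efh).
have [c [c0 fa' efh' ah']] := scaled_triple ea fa efh ah.
have := triple_kappa_gt0 ea fa' efh' ah'.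
by rewrite [vsval _]linearZ kappaZl kappaZr kh !mulr0 ltxx.
Qed.

Lemma common_kernel (I : finType) (f : I -> g -> K^o) :
  (forall i, linear (f i)) ->
  exists U : {vspace g}, forall x, x \in U <-> forall i, f i x = 0.
Proof.
move=> flin; pose F i : {linear g -> K^o} :=
  HB.pack (f i) (GRing.isLinear.Build K g K^o _ _ (flin i)).
exists (\bigcap_i lker (linfun (F i)))%VS => x; rewrite memvE; split=> [/subv_bigcapP xU i|xU].
  by have := xU i isT; rewrite -memvE memv_ker lfunE => /eqP.
by apply/subv_bigcapP => i _; rewrite -memvE memv_ker lfunE /= xU.
Qed.

Lemma kappa_neq0 : exists x y, kappa x y != 0.
Proof.
apply: contrapT => k0; have {}k0 x y : kappa x y = 0.
  by apply: contrapT => /eqP xy; apply: k0; exists x, y.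
have br0 a e f : e \in rootspace a -> f \in rootspace (- a) -> lie e f = 0.
  move=> ea fa; have [h efh] := lie_opp_rootspace ea fa.
  by rewrite efh (kappa_bracket_eq0 ea fa efh).
(* [U] is the span of the root vectors, cut out by the vanishing of the coordinates of weight 0. *)
have [U UP] := @common_kernel {i | lam i == 0} (fun i => coord X (val i))
  (fun i => linearP _).
have [[x [y xy]] ideals] := gS; have [tA _ _] := tC.
have {}UP z : z \in U <-> forall i, lam i = 0 -> coord X i z = 0.
  rewrite UP; split=> [zU i /eqP i0|zU [i /= /eqP i0]]; last exact: zU.
  exact: zU (exist _ i i0).
have [u z zU|U0|Uf] := ideals U.
- apply/UP => i i0; rewrite (coord_expand Xb u).
  rewrite lie_suml linear_sum big1// => j _.
  rewrite (coord_expand Xb z) !linear_sum big1// => k _ /=.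
  rewrite lieZl lieZr !linearZ /=.
  have [k0'|k0'] := eqVneq (lam k) 0; first by rewrite (UP z).1// mul0r mulr0.
  have [jk|jk] := eqVneq (lam k) (- lam j).
    by rewrite (br0 (lam j)) ?linear0 ?mulr0 -?jk ?tnth_rootspace.
  have /memv_rootspace-> := lie_rootspace (tnth_rootspace j) (tnth_rootspace k).
    by rewrite !mulr0.
  by rewrite i0 eq_sym addrC addr_eq0.
(* Without any root vector, [g] equals [t] and is abelian. *)
- have lam0 i : lam i = 0.
    apply: contrapT => i0; have : tnth X i \in U.
      by apply/UP => j j0; rewrite (coord_tnth Xb); case: eqP => // ji; rewrite -ji in i0.
    by rewrite U0 memv0 (negPf (tnth_neq0 i)).
  have xt z : z \in t.
    by apply/rootspace0/memv_rootspace => i; rewrite lam0 eqxx.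
  by rewrite tA ?eqxx// in xy.
(* No weight is 0, so [t], being the weight space of 0, is trivial; every weight is then 0 as a form
   on [t], a contradiction. *)
- have lam0 i : lam i != 0.
    apply/eqP => i0; have /UP/(_ i i0) : tnth X i \in U by rewrite Uf memvf.
    by rewrite (coord_tnth Xb) eqxx => /eqP; rewrite oner_eq0.
  suff x0 : x = 0 by rewrite x0 lie0l eqxx in xy.
  apply: coord_eq0 => i; have /eqP[] := lam0 i.
  apply/lfunP => h; rewrite zero_lfunE; suff -> : h = 0 by rewrite linear0.
  apply: subvs_inj; rewrite linear0; apply: coord_eq0 => j.
  have /rootspace0/memv_rootspace-> // := subvsP h; exact: lam0.
Qed.

Lemma kappa_nondegenerate x : (forall y, kappa x y = 0) -> x = 0.
Proof.
have [U UP] := common_kernel (fun j => kappa_linear (tnth X j)).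
have {}UP z : z \in U <-> forall y, kappa z y = 0.
  rewrite UP; split=> [zU y|zU j]; last by rewrite kappaC.
  rewrite (coord_expand Xb y) linear_sum.
  by rewrite big1// => j _; rewrite /= kappaZr kappaC zU mulr0.
have [_ ideals] := gS; move=> /UP xU.
have [u z /UP zU|U0|Uf] := ideals U; last 2 first.
- by apply/eqP; rewrite -memv0 -U0.
- have [u [v]] := kappa_neq0; have /UP-> : u \in U by rewrite Uf memvf.
  by rewrite eqxx.
by apply/UP => y; rewrite lieC -scaleN1r kappaZl kappaA zU mulr0.
Qed.

(** * Roots, coroots and reducedness *)

Lemma root_neq0 a : is_root a -> a != 0.
Proof. by case/andP. Qed.

Lemma root_weight a : is_root a -> exists i, lam i = a.
Proof. by case/andP => _ /rootspace_neq0. Qed.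

(** Nondegeneracy gives a basis vector pairing with [e], and orthogonality of weight spaces places
    it in [g_(-a)]. If [a h] were 0, then [h] would be 0 and [kappa_pairing] would make [a]
    vanish. *)
Lemma root_triple a : is_root a -> exists e f h,
  [/\ e \in rootspace a, f \in rootspace (- a), lie e f = vsval h & a h = 2].
Proof.
move=> ar; have [i ia] := root_weight ar; have ea := tnth_rootspace i.
set e := tnth X i in ea; rewrite ia in ea.
have [j ej] : exists j, kappa e (tnth X j) != 0.
  apply: contrapT => H; have /eqP[] := tnth_neq0 i.
  apply: kappa_nondegenerate => y; rewrite (coord_expand Xb y) linear_sum big1// => j _.
  rewrite linearZ /=; suff -> : kappa e (tnth X j) = 0 by rewrite scaler0.
  by apply: contrapT => /eqP ?; apply: H; exists j.
have fa : tnth X j \in rootspace (- a).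
  rewrite -(_ : lam j = - a) ?tnth_rootspace//; apply/eqP; rewrite -addr_eq0 addrC.
  by apply: contraNT ej => aj; rewrite (kappa_rootspace ea (tnth_rootspace j) aj).
have [h efh] := lie_opp_rootspace ea fa.
have ah : a h != 0.
  apply: contra_neq (root_neq0 ar) => /(bracket_eq0 ea fa efh) h0.
  apply/lfunP => h'; have := kappa_pairing h' ea fa; rewrite efh h0 linear0.
  rewrite kappaC linear0 => /esym/eqP; rewrite mulf_eq0 (negPf ej) orbF.
  by rewrite zero_lfunE => /eqP.
have [c [_ fa' efh' ah']] := scaled_triple ea fa efh ah.
by exists e, (c *: tnth X j), (c *: h).
Qed.

Lemma coroot_triple a : is_root a -> a (coroot a) = 2 /\ exists e f,
  [/\ e \in rootspace a, f \in rootspace (- a) & lie e f = vsval (coroot a)].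
Proof.
move=> /root_triple[e [f [h [ea fa efh ah]]]]; rewrite /coroot.
(* The set is inhabited, so the default 0 of [xget] never occurs. *)
by case: xgetP => [h' _ //|/(_ h)[]]; split=> //; exists e, f.
Qed.

Lemma root_coroot a : is_root a -> a (coroot a) = 2.
Proof. by case/coroot_triple. Qed.

Lemma root_string a b : is_root a -> is_root b -> exists z : int,
  b (coroot a) = z%:~R /\
  forall k : nat, k%:Z <= z -> rootspace (b - a *+ k) != 0%VS.
Proof.
move=> /coroot_triple[ah [e [f [ea fa efh]]]] /root_weight[i <-].
have [z [zE _ zk]] := sl2_string ea fa efh ah (tnth_rootspace i) (tnth_neq0 i).
by exists z.
Qed.

Lemma root_opp_string a b : is_root a -> is_root b -> exists z : int,
  b (coroot a) = - z%:~R /\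
  forall k : nat, k%:Z <= z -> rootspace (b + a *+ k) != 0%VS.
Proof.
move=> /coroot_triple[ah [e [f [ea fa efh]]]] /root_weight[i <-].
have [|z [zE _ zk]] := sl2_string fa _ (triple_opp efh) (triple_opp_root ah)
  (tnth_rootspace i) (tnth_neq0 i); first by rewrite opprK.
exists z; split=> [|k /zk]; first by rewrite -zE linearN opprK.
by rewrite mulNrn opprK.
Qed.

(** With [z = b (coroot a)], the weight [b - z a] lies on the descending string of [b] if [z >= 0],
    and on the ascending one otherwise. *)
Lemma refl_root a b : is_root a -> is_root b -> is_root (refl a b).
Proof.
move=> ar br; rewrite /is_root reflE; apply/andP; split.
  (* If [b = c a] with [c = b (coroot a)], evaluation at [coroot a] gives [c = 2 c]. *)
  apply: contraNneq (root_neq0 br) => /eqP; rewrite subr_eq0 => /eqP bE.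
  have := congr1 (fun l : dual_space t => l (coroot a) : K) bE.
  rewrite scale_lfunE (root_coroot ar); set c : K := b (coroot a) => cE.
  suff c0 : c = 0 by rewrite bE -/c c0 scale0r.
  have /eqP : c = c * 2 by exact: cE.
  by rewrite mulr_natr mulr2n -subr_eq0 opprD addNKr oppr_eq0 => /eqP.
have [z [zE zk]] := root_string ar br; have [z' [zE' zk']] := root_opp_string ar br.
have zz' : z = - z' by apply: (@mulrIz K 1); rewrite ?oner_eq0// mulrNz -zE' -zE.
have [z0|z0] := leP 0 z.
  have := zk `|z|%N; rewrite zE gez0_abs// => /(_ (lexx _)).
  by rewrite -{2}(gez0_abs z0) scaler_int.
have z'0 : 0 <= z' by lia.
have := zk' `|z'|%N; rewrite zE' gez0_abs// => /(_ (lexx _)).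
by rewrite -{2}(gez0_abs z'0) scaleNr opprK scaler_int.
Qed.

Lemma opp_root a : is_root a -> is_root (- a).
Proof.
move=> ar; have := refl_root ar ar; rewrite reflE (root_coroot ar).
by rewrite scaler_nat mulr2n opprD addNKr.
Qed.

Lemma root_sub a b : is_root a -> is_root b -> a != b -> 0 < (a (coroot b) : K) ->
  is_root (a - b).
Proof.
move=> ar br ab; have [z [-> zk]] := root_string br ar; rewrite ltr0z => z0.
by rewrite /is_root subr_eq0 ab -[b in a - b]mulr1n zk.
Qed.

(** Under the trace form, [coroot a] represents [a] up to the factor [kappa e f], which is positive
    because [kappa h h = 2 kappa e f] for [h = coroot a]. *)
Lemma coroot_kappa a : is_root a ->
  exists2 c, 0 < c & forall h, kappa (vsval (coroot a)) (vsval h) = c * a h.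
Proof.
move=> /coroot_triple[ah [e [f [ea fa efh]]]]; exists (kappa e f); last first.
  by move=> h; rewrite -efh (kappa_pairing h ea fa) mulrC.
have := triple_kappa_gt0 ea fa efh ah.
by rewrite -{1}efh (kappa_pairing _ ea fa) ah pmulr_rgt0// ltr0n.
Qed.

(** [kappa (coroot a) (coroot b)] is a positive multiple of each of the two pairings. *)
Lemma coroot_sym a b : is_root a -> is_root b ->
  0 < (a (coroot b) : K) -> 0 < (b (coroot a) : K).
Proof.
move=> /coroot_kappa[ca ca0 caE] /coroot_kappa[cb cb0 cbE] ab.
have := caE (coroot b); rewrite kappaC cbE => abE.
by rewrite -(pmulr_rgt0 _ cb0) [X in 0 < X]abE pmulr_rgt0.
Qed.

(** In the opposite triple [f] is the raising element, so a nonzero [x] would be a highest vector of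
    weight [-2(n + 1) < 0]. *)
Lemma opp_string_killed a e f h n x : e \in rootspace a -> f \in rootspace (- a) ->
  lie e f = vsval h -> a h = 2 -> x \in rootspace (a *+ n.+1) -> lie f x = 0 -> x = 0.
Proof.
move=> ea fa efh ah xa fx; have [//|x0] := eqVneq x 0.
have eNa : e \in rootspace (- - a) by rewrite opprK.
have [z [zE /(_ fx) z0 _]] :=
  sl2_string fa eNa (triple_opp efh) (triple_opp_root ah) xa x0.
have : (z + (n.+1 * 2)%:Z)%:~R = 0 :> K.
  rewrite rmorphD /= -zE linearN /= -scaler_nat scale_lfunE ah -pmulrn natrM.
  exact: addNr.
by move/eqP; rewrite intr_eq0 => /eqP; lia.
Qed.

(** Pairing with [f] is injective on [g_a], which therefore has dimension 1: if [x] is orthogonal to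
    [f], then [[x, f]] is orthogonal to itself, hence 0, and [f] kills [x]. *)
Lemma root_kappa_eq0 a e f h x : e \in rootspace a -> f \in rootspace (- a) ->
  lie e f = vsval h -> a h = 2 -> x \in rootspace a -> kappa x f = 0 -> x = 0.
Proof.
move=> ea fa efh ah xa xf; apply: (@opp_string_killed a e f h 0) => //.
have [h' xfh] := lie_opp_rootspace xa fa.
have h'0 : h' = 0.
  apply: (kappa_bracket_eq0 xa fa xfh).
  by rewrite -{1}xfh (kappa_pairing _ xa fa) xf mulr0.
by rewrite lieC xfh h'0 linear0.
Qed.

Lemma root_weight_inj i j : is_root (lam i) -> lam i = lam j -> i = j.
Proof.
move=> ir ij; have [e [f [h [ea fa efh ah]]]] := root_triple ir.
have [//|ji] := eqVneq i j; have := tnth_neq0 j.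
have xj : tnth X j \in rootspace (lam i) by rewrite ij tnth_rootspace.
rewrite (root_kappa_eq0 ea fa efh ah xj) ?eqxx//.
have : kappa (tnth X j) f *: tnth X i - kappa (tnth X i) f *: tnth X j = 0.
  apply: (root_kappa_eq0 ea fa efh ah).
    by rewrite memvB ?memvZ ?tnth_rootspace.
  by rewrite -scaleNr kappaDl !kappaZl mulNr mulrC subrr.
move=> /(congr1 (coord X i)); rewrite linearB !linearZ /= !(coord_tnth Xb) eqxx.
by rewrite (negPf ji) mulr0 subr0 mulr1 linear0.
Qed.

(** For [x] of weight [2a], the vector [[f, x]] lies in [g_a] and is orthogonal to [f] by
    invariance, so it vanishes; then so does [x]. *)
Lemma double_root a : is_root a -> ~~ is_root (a *+ 2).
Proof.
move=> ar; apply/negP => /root_weight[i i2].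
have [e [f [h [ea fa efh ah]]]] := root_triple ar.
have xa : tnth X i \in rootspace (a *+ 2) by rewrite -i2 tnth_rootspace.
have /eqP[] := tnth_neq0 i; apply: (opp_string_killed ea fa efh ah xa).
apply: (root_kappa_eq0 ea fa efh ah).
  by have := lie_rootspace fa xa; rewrite mulr2n addKr.
by rewrite lieC -scaleN1r kappaZl kappaA liexx linear0 mulr0.
Qed.

(** Both [2c] and [2/c] are integers, with product 4. The values 1 and 4 of [|2c|] would make one of
    [a], [c a] twice the other up to sign. *)
Lemma root_multiple a (c : K) : is_root a -> is_root (c *: a) -> c = 1 \/ c = -1.
Proof.
move=> ar car; have c0 : c != 0.
  by apply: contraNneq (root_neq0 car) => ->; rewrite scale0r.
have [z [zE _]] := root_string ar car; have [z' [zE' _]] := root_string car ar.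
have {}zE : z%:~R = c * 2 by rewrite -zE scale_lfunE (root_coroot ar).
have {}zE' : c * z'%:~R = 2 by rewrite -zE' -(root_coroot car) scale_lfunE.
have zz' : z * z' = 4.
  apply: (@intr_inj K); rewrite intrM zE mulrAC zE'.
  by rewrite -natrM.
have not1 d : is_root (d *: a) -> d * 2 <> 1.
  move=> dar d2; have /negP[] := double_root dar.
  by rewrite -scaler_nat scalerA mulrC d2 scale1r.
have not4 d : is_root (d *: a) -> d * 2 <> 2 * 2.
  move=> dar /(mulIf _) d2; have /negP[] := double_root ar.
  by rewrite -scaler_nat -d2// pnatr_eq0.
have cNar : is_root (- c *: a) by rewrite scaleNr opp_root.
have two : c * 2 = 2 -> c = 1.
  by move=> c2; apply: (@mulIf K 2); rewrite ?pnatr_eq0// mul1r.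
have twoN : c * 2 = - 2 -> c = -1.
  by move=> c2; apply: (@mulIf K 2); rewrite ?pnatr_eq0// mulN1r.
have : z = 1 \/ z = 2 \/ z = 4 \/ z = -1 \/ z = -2 \/ z = -4.
  have z4 : (`|z| <= 4)%N.
    by apply: dvdn_leq => //; apply/dvdnP; exists `|z'|%N; rewrite mulnC -abszM zz'.
  have [z0|z0] : z = 0 \/ z <> 0 by lia.
    by rewrite z0 mul0r in zz'.
  have [z3|z3] : (z = 3 \/ z = -3) \/ (z <> 3 /\ z <> -3) by lia.
    by case: z3 zz' => ->; lia.
  by lia.
case=> [z1|[z2|[z4|[z1|[z2|z4]]]]].
- by case: (not1 _ car); rewrite -zE z1.
- by left; apply: two; rewrite -zE z2.
- by case: (not4 _ car); rewrite -zE z4 -natrM.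
- by case: (not1 _ cNar); rewrite mulNr -zE z1 mulrNz opprK.
- by right; apply: twoN; rewrite -zE z2 mulrNz.
- by case: (not4 _ cNar); rewrite mulNr -zE z4 mulrNz opprK -natrM.
Qed.

(** Needed for [dim g(1)]. By [root_weight_inj], each root of [s] is the weight of exactly one
    [X_i], and these vectors span the sum. *)
Lemma dim_sum_rootspace (s : seq (dual_space t)) : uniq s -> {in s, forall a, is_root a} ->
  \dim (\sum_(a <- s) rootspace a)%VS = size s.
Proof.
move=> us sr; pose s' := [seq i <- enum 'I_m | lam i \in s].
have ss' : perm_eq [seq lam i | i <- s'] s.
  apply: uniq_perm => //.
    rewrite map_inj_in_uniq; first by apply: filter_uniq; apply: enum_uniq.
    move=> i j.
    by rewrite !mem_filter => /andP[/sr ir _] _; apply: root_weight_inj.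
  move=> a; apply/mapP/idP => [[j]|sa]; first by rewrite mem_filter => /andP[js _] ->.
  have [i ia] := root_weight (sr _ sa); exists i => //.
  by rewrite mem_filter ia sa mem_enum.
have -> : (\sum_(a <- s) rootspace a)%VS = <<[seq tnth X i | i <- s']>>%VS.
  apply/eqP; rewrite eqEsubv; apply/andP; split.
    rewrite big_seq; elim/big_ind: _ => [|U V|a sa]; first exact: sub0v.
      by rewrite subv_add => -> ->.
    apply/subvP => x /memv_rootspace xa; rewrite (coord_expand Xb x) memv_suml// => i _.
    have [ia|/xa ->] := eqVneq (lam i) a; last by rewrite scale0r mem0v.
    by rewrite memvZ// memv_span// map_f// mem_filter ia sa mem_enum.
  apply/span_subvP => _ /mapP[i + ->]; rewrite mem_filter => /andP[sa _].
  rewrite (big_rem _ sa) /=; exact: (subvP (addvSl _ _) _ (tnth_rootspace i)).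
have /eqP -> : free [seq tnth X i | i <- s'].
  apply: (@catl_free _ _ [seq tnth X i | i <- [seq i <- enum 'I_m | lam i \notin s]]).
  rewrite -map_cat (perm_free (perm_map _ (permEl (perm_filterC _ _)))).
  by rewrite map_tnth_enum (basis_free Xb).
by rewrite size_map -(perm_size ss') size_map.
Qed.

Lemma root_seq : exists rs : seq (dual_space t), forall a, is_root a = (a \in rs).
Proof.
exists [seq lam i | i <- enum 'I_m & lam i != 0] => a.
apply/idP/mapP => [ar|[j]].
  have [i ia] := root_weight ar.
  by exists i; rewrite // mem_filter ia root_neq0//= mem_enum.
rewrite mem_filter => /andP[j0 _] ->; rewrite /is_root j0.
by apply/rootspace_neq0; exists j.
Qed.

End KillingForm.

(** The interface between the Lie algebra and the combinatorics of its roots. [rs_sym] replaces the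
    symmetry of an inner product, and [rs_multiple] says that the system is reduced. *)
Record root_axioms (K : numFieldType) (g : lieAlgType K) (t : {vspace g}) : Prop := {
  rs_finite : exists rs : seq (dual_space t), forall a, is_root a = (a \in rs);
  rs_coroot : forall a : dual_space t, is_root a -> a (coroot a) = 2;
  rs_refl : forall a b : dual_space t, is_root a -> is_root b -> is_root (refl a b);
  rs_opp : forall a : dual_space t, is_root a -> is_root (- a);
  rs_int : forall a b : dual_space t, is_root a -> is_root b ->
    exists z : int, b (coroot a) = z%:~R;
  rs_sub : forall a b : dual_space t, is_root a -> is_root b -> a != b ->
    0 < (a (coroot b) : K) -> is_root (a - b);
  rs_sym : forall a b : dual_space t, is_root a -> is_root b ->
    0 < (a (coroot b) : K) -> 0 < (b (coroot a) : K);
  rs_multiple : forall (a : dual_space t) (c : K),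
    is_root a -> is_root (c *: a) -> c = 1 \/ c = -1 }.

Lemma simple_root_axioms (K : numFieldType) (g : lieAlgType K) (t : {vspace g}) :
  simple_lie g -> cartan_subalgebra t -> root_axioms t.
Proof.
move=> gS tC; have [X [lam [Xb XE]]] := weight_basis tC; split.
- exact: (root_seq Xb XE).
- exact: (root_coroot gS tC Xb XE).
- exact: (refl_root gS tC Xb XE).
- exact: (opp_root gS tC Xb XE).
- move=> a b ar br; have [z [zE _]] := root_string gS tC Xb XE ar br.
  by exists z.
- exact: (root_sub gS tC Xb XE).
- exact: (coroot_sym gS tC Xb XE).
- exact: (root_multiple gS tC Xb XE).
Qed.

Lemma dim_sum_root_spaces (K : numFieldType) (g : lieAlgType K) (t : {vspace g})
    (s : seq (dual_space t)) :
  simple_lie g -> cartan_subalgebra t -> uniq s -> {in s, forall a, is_root a} ->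
  \dim (\sum_(a <- s) rootspace a)%VS = size s.
Proof.
move=> gS tC; have [X [lam [Xb XE]]] := weight_basis tC.
exact: (dim_sum_rootspace gS tC Xb XE).
Qed.

(** * Positive roots and the Weyl group *)

(** The rank is a relation because heights are elements of [K], known to be natural numbers only on
    the elements at hand. *)
Lemma ex_minimal_rank (T : Type) (le : T -> T -> Prop) (rk : nat -> T -> Prop) (M : set T) :
  (forall x, le x x) -> (forall x y z, le x y -> le y z -> le x z) ->
  (forall k x y, M x -> M y -> le y x -> y <> x -> rk k x ->
    exists2 k', (k' < k)%N & rk k' y) ->
  forall k x, M x -> rk k x -> exists y, minimal le M y /\ le y x.
Proof.
move=> le_refl le_trans rkM; elim/ltn_ind => k IH x Mx xk.
have [[y [My yx yNx]]|H] := pselect (exists y, [/\ M y, le y x & y <> x]).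
  have [k' kk' yk'] := rkM _ _ _ Mx My yx yNx xk.
  have [z [zmin zy]] := IH _ kk' _ My yk'.
  by exists z; split=> //; apply: le_trans yx.
exists x; split=> //; split=> // y My yx; apply: contrapT => yNx; apply: H.
by exists y.
Qed.

Section RootCombinatorics.
Context (K : numFieldType) (g : lieAlgType K) (t : {vspace g}).
Context (n : nat) (Pi : n.-tuple (dual_space t)).
Context (rsys : root_axioms t) (PiB : is_base Pi).
Implicit Types (a b c l : dual_space t) (w u v : 'End(dual_space t)).
Implicit Types (s : seq (dual_space t)).

Local Notation pos := (positive_roots Pi).
Local Notation W := (weyl_group t).
Local Notation simple := [set` Pi].

Let Pib : basis_of fullv Pi. Proof. by case: PiB. Qed.

Lemma simple_root a : a \in Pi -> is_root a.
Proof. by case: PiB => _ + _; apply. Qed.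

Lemma nneg_combE a : nneg_comb Pi a <-> forall j, exists k : nat, coord Pi j a = k%:R.
Proof.
split=> [[k ->] j|/choice[k kE]]; last first.
  by exists k; rewrite (coord_expand Pib a); apply: eq_bigr => j _; rewrite kE scaler_nat.
exists (k j); rewrite linear_sum (bigD1 j)//= big1 ?addr0 => [|l lj];
  rewrite -scaler_nat linearZ /= (coord_tnth Pib).
  by rewrite eqxx mulr1.
by rewrite eq_sym (negPf lj) mulr0.
Qed.

Lemma nneg_combD a b : nneg_comb Pi a -> nneg_comb Pi b -> nneg_comb Pi (a + b).
Proof.
move=> /nneg_combE an /nneg_combE bn; apply/nneg_combE => j.
have [[k kE] [k' kE']] := (an j, bn j).
by exists (k + k')%N; rewrite linearD /= kE kE' natrD.
Qed.

Lemma nneg_combMn a k : nneg_comb Pi a -> nneg_comb Pi (a *+ k).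
Proof.
move=> /nneg_combE an; apply/nneg_combE => j; have [k' kE] := an j.
by exists (k' * k)%N; rewrite -scaler_nat linearZ /= kE mulrC natrM.
Qed.

Lemma nneg_comb0 : nneg_comb Pi 0.
Proof. by apply/nneg_combE => j; exists 0%N; rewrite linear0. Qed.

Lemma nneg_coord a : nneg_comb Pi a -> forall j, 0 <= coord Pi j a.
Proof. by move=> /nneg_combE an j; have [k ->] := an j; rewrite ler0n. Qed.

Lemma pos_root a : pos a -> is_root a. Proof. by case. Qed.

Lemma simple_pos a : a \in Pi -> pos a.
Proof.
move=> aPi; split; first exact: simple_root.
have /tnthP[j ->] := aPi; apply/nneg_combE => k.
by exists (k == j); rewrite (coord_tnth Pib).
Qed.

#[local] Opaque coroot is_root refl.

Lemma pos_or_neg a : is_root a -> pos a \/ pos (- a).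
Proof.
move=> ar; have [_ _ PiN] := PiB; case: (PiN a ar) => an; [left|right].
  by split; [exact: ar|exact: an].
by split; [exact: (rs_opp rsys ar)|exact: an].
Qed.

Lemma pos_coord_gt0 a : pos a -> exists j, 0 < coord Pi j a.
Proof.
move=> [ar an]; apply: contrapT => a0; have /eqP[] := root_neq0 ar.
apply: (coord_inj Pib) => j; rewrite linear0; apply: contrapT => /eqP aj; apply: a0.
by exists j; rewrite lt_def aj nneg_coord.
Qed.

Lemma coord_gt0_pos a j : is_root a -> 0 < coord Pi j a -> pos a.
Proof.
move=> ar j0; have [//|[_ /nneg_coord/(_ j)]] := pos_or_neg ar.
by rewrite linearN oppr_ge0 => /(lt_le_trans j0); rewrite ltxx.
Qed.

Lemma pos_neg_false a : pos a -> pos (- a) -> False.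
Proof.
move=> /pos_coord_gt0[j j0] [_ /nneg_coord/(_ j)].
by rewrite linearN oppr_ge0 => /(lt_le_trans j0); rewrite ltxx.
Qed.

Definition height : dual_space t -> K := fun a => \sum_j coord Pi j a.

Lemma heightD a b : height (a + b) = height a + height b.
Proof. by rewrite -big_split; apply: eq_bigr => j _; rewrite linearD. Qed.

Lemma heightN a : height (- a) = - height a.
Proof. by rewrite -sumrN; apply: eq_bigr => j _; rewrite linearN. Qed.

Lemma heightZ (x : K) a : height (x *: a) = x * height a.
Proof. by rewrite mulr_sumr; apply: eq_bigr => j _; rewrite linearZ. Qed.

Lemma height_simple a : a \in Pi -> height a = 1.
Proof.
move=> /tnthP[j ->]; rewrite /height (bigD1 j)//= (coord_tnth Pib) eqxx big1 ?addr0//.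
by move=> k kj; rewrite (coord_tnth Pib) (negPf kj).
Qed.

Lemma height_nneg a : nneg_comb Pi a -> exists k : nat, height a = k%:R.
Proof.
move=> /nneg_combE/choice[k kE]; exists (\sum_j k j)%N.
by rewrite natr_sum; apply: eq_bigr => j _; rewrite kE.
Qed.

Lemma height_pos a : pos a -> exists k : nat, height a = k.+1%:R.
Proof.
move=> ap; have [[|k] kE] := height_nneg ap.2; last by exists k.
have [j j0] := pos_coord_gt0 ap; move/eqP: kE; rewrite /height psumr_eq0 => [|k _].
  by move=> /allP/(_ j); rewrite mem_index_enum => /(_ isT)/eqP aj; rewrite aj ltxx in j0.
exact: (nneg_coord ap.2).
Qed.

(* As [a (coroot a) = 2 > 0], some simple root occurring in [a] pairs positively
   with the coroot of [a]. *)
Lemma acute_simple a : pos a ->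
  exists b, [/\ b \in Pi, 0 < (b (coroot a) : K) & 0 < (a (coroot b) : K)].
Proof.
move=> ap; have ar := pos_root ap; apply: contrapT => H.
suff : (a (coroot a) : K) <= 0 by rewrite (rs_coroot rsys ar) lern0.
rewrite {1}(coord_expand Pib a) sum_lfunE; apply: sumr_le0 => j _.
rewrite scale_lfunE; have /nneg_combE/(_ j)[k ->] := ap.2.
have jPi := mem_tnth j Pi; have [z zE] := rs_int rsys ar (simple_root jPi).
rewrite zE; have [k0|k0] := posnP k; first by rewrite k0 scale0r.
have [z0|z0] := leP z 0.
  have : (k%:Z * z)%:~R <= 0 :> K by rewrite lerz0; nia.
  by rewrite intrM.
have z0' : 0 < (tnth Pi j (coroot a) : K) by rewrite zE ltr0z.
case: H; exists (tnth Pi j); split; [exact: jPi|exact: z0'|].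
exact: (rs_sym rsys (simple_root jPi) ar z0').
Qed.

(** [s_a] changes the coefficient of [a] only, so another positive coefficient of [b] survives. If
    there is none, [b] is a multiple of [a], and reducedness leaves [a] and [-a], both excluded. *)
Lemma simple_refl_pos a b : a \in Pi -> pos b -> b != a -> pos (refl a b).
Proof.
move=> aPi bp ba; have /tnthP[j aE] := aPi; have ar := simple_root aPi.
have [[k [kj k0]]|H] := pselect (exists k, k != j /\ 0 < coord Pi k b).
  apply: (@coord_gt0_pos _ k); first exact: (rs_refl rsys ar (pos_root bp)).
  by rewrite reflE linearB linearZ /= aE (coord_tnth Pib) (negPf kj) mulr0 subr0.
have bE : b = coord Pi j b *: a.
  apply: (coord_inj Pib) => k; rewrite linearZ /= aE (coord_tnth Pib).
  have [->|kj] := eqVneq k j; first by rewrite mulr1.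
  rewrite mulr0; apply: contrapT => /eqP k0; apply: H; exists k; split=> //.
  by rewrite lt_def k0 (nneg_coord bp.2).
have := pos_root bp; rewrite bE => /(rs_multiple rsys ar)[b1|b1].
  by case/eqP: ba; rewrite bE b1 scale1r.
by case: (pos_neg_false (simple_pos aPi)); rewrite -scaleN1r -b1 -bE.
Qed.

Lemma pos_sub_simple a : pos a -> a \notin Pi -> exists2 b, b \in Pi & pos (a - b).
Proof.
move=> ap aPi; have [b [bPi ba _]] := acute_simple ap; exists b => //.
have br := simple_root bPi; have ar := pos_root ap.
have bna : b != a by apply: contraNneq aPi => <-.
have abr : is_root (a - b) by rewrite -opprB; exact: (rs_opp rsys (rs_sub rsys br ar bna ba)).
(* Were [b - a] positive, the simple root [b], of height 1, would be the sum of two roots of height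
   at least 1. *)
have [//|] := pos_or_neg abr; rewrite opprB => /height_pos[k].
rewrite heightD heightN (height_simple bPi); have [k' ->] := height_pos ap.
move=> /eqP; rewrite subr_eq -natrD (eqr_nat K 1) => /eqP; lia.
Qed.

(** * Products of reflections and the Weyl group *)

Lemma refl_prod_cons a s : refl_prod (a :: s) = (refl a \o refl_prod s)%VF.
Proof. exact: big_cons. Qed.

Lemma refl_prod_cat s s' : refl_prod (s ++ s') = (refl_prod s \o refl_prod s')%VF.
Proof.
elim: s => [|a s IH]; first by rewrite /refl_prod big_nil comp_lfun1l.
by rewrite cat_cons !refl_prod_cons IH comp_lfunA.
Qed.

Lemma refl_prod1 a : refl_prod [:: a] = refl a.
Proof. by rewrite refl_prod_cons /refl_prod big_nil comp_lfun1r. Qed.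

Lemma refl_group1 A : refl_group A (\1%VF : 'End(dual_space t)).
Proof. by exists [::] => //; rewrite /refl_prod big_nil. Qed.

Lemma refl_groupM A u v : refl_group A u -> refl_group A v -> refl_group A (u \o v)%VF.
Proof.
move=> [s sA ->] [s' sA' ->]; exists (s ++ s'); last by rewrite refl_prod_cat.
by move=> a; rewrite mem_cat => /orP[/sA|/sA'].
Qed.

Lemma refl_group_refl (A : set (dual_space t)) a : A a -> refl_group A (refl a).
Proof.
by move=> aA; exists [:: a]; rewrite ?refl_prod1// => b; rewrite inE => /eqP ->.
Qed.

Lemma refl_group_ind (A : set (dual_space t)) (P : 'End(dual_space t) -> Prop) : P \1%VF ->
  (forall a w, A a -> refl_group A w -> P w -> P (refl a \o w)%VF) ->
  forall w, refl_group A w -> P w.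
Proof.
move=> P1 PM w [s sA ->]; elim: s sA => [|a s IH] sA.
  by rewrite /refl_prod big_nil.
have sA' : {in s, forall b, A b} by move=> b bs; apply: sA; rewrite inE bs orbT.
rewrite refl_prod_cons; apply: PM; [|by exists s|exact: IH].
by apply: sA; rewrite inE eqxx.
Qed.

Lemma refl_self a : is_root a -> refl a a = - a.
Proof. by move=> ar; rewrite reflE (rs_coroot rsys ar) scaler_nat mulr2n opprD addNKr. Qed.

Lemma reflK a : is_root a -> (refl a \o refl a)%VF = \1%VF.
Proof.
move=> ar; apply/lfunP => l; rewrite comp_lfunE id_lfunE.
rewrite [refl a l]reflE linearB linearZ /= (refl_self ar) reflE scalerN opprK.
by rewrite subrK.
Qed.

Lemma refl_group_inv (A : set (dual_space t)) w : (forall a, A a -> is_root a) ->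
  refl_group A w ->
  exists v, [/\ refl_group A v, (v \o w)%VF = \1%VF & (w \o v)%VF = \1%VF].
Proof.
move=> Ar; move: w; apply: refl_group_ind => [|a u aA uA [v [vA vu uv]]].
  by exists \1%VF; rewrite comp_lfun1l; split=> //; apply: refl_group1.
exists (v \o refl a)%VF; split.
- by apply: refl_groupM => //; apply: refl_group_refl.
- by rewrite -comp_lfunA [(refl a \o _)%VF]comp_lfunA (reflK (Ar _ aA)) comp_lfun1l.
- by rewrite -comp_lfunA [(u \o _)%VF]comp_lfunA uv comp_lfun1l (reflK (Ar _ aA)).
Qed.

Lemma weyl_inv w : W w -> exists v, [/\ W v, (v \o w)%VF = \1%VF & (w \o v)%VF = \1%VF].
Proof. by apply: refl_group_inv. Qed.

Lemma weyl_refl a : is_root a -> W (refl a).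
Proof. by move=> ar; apply: refl_group_refl. Qed.

Lemma weyl_root w a : W w -> is_root a -> is_root (w a).
Proof.
move=> Ww; move: w Ww a; apply: refl_group_ind => [a|b u br _ IH a ar].
  by rewrite id_lfunE.
by rewrite comp_lfunE; exact: (rs_refl rsys br (IH _ ar)).
Qed.

Lemma weyl_inj w a b : W w -> w a = w b -> a = b.
Proof.
move=> /weyl_inv[v [_ vw _]] /(congr1 v).
by rewrite -!comp_lfunE vw !id_lfunE.
Qed.

Lemma root_line_finite a b : (forall k : nat, is_root (b + a *+ k)) -> a = 0.
Proof.
move=> H; have [rs rsE] := rs_finite rsys; apply: contrapT => /eqP a0.
pose line := [seq b + a *+ k | k <- iota 0 (size rs).+1].
have : (size line <= size rs)%N.
  apply: uniq_leq_size => [|_ /mapP[k _ ->]]; last by rewrite -rsE.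
  rewrite map_inj_uniq ?iota_uniq// => k k' /addrI/eqP.
  rewrite -!scaler_nat -subr_eq0 -scalerBl scaler_eq0 (negPf a0) orbF subr_eq0.
  by rewrite eqr_nat => /eqP.
by rewrite size_map size_iota ltnn.
Qed.

(* [w^-1 s_(w a) w s_a] translates every [l] by a multiple [d l] of [a], and [d]
   vanishes at [a]; since it permutes the finitely many roots, [d = 0]. *)
Lemma weyl_conj w a : W w -> is_root a -> (w \o refl a)%VF = (refl (w a) \o w)%VF.
Proof.
move=> Ww ar; have [v [Wv vw wv]] := weyl_inv Ww.
pose d l : K := l (coroot a) - w l (coroot (w a)).
have vwE l : v (w l) = l by rewrite -comp_lfunE vw id_lfunE.
have war := weyl_root Ww ar.
pose tau l := v (refl (w a) (w (refl a l))).
have tauE l : tau l = l + d l *: a.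
  rewrite /tau [refl a l]reflE linearB linearZ /= reflE.
  rewrite add_lfunE opp_lfunE scale_lfunE (rs_coroot rsys war).
  rewrite !(linearB v) !linearZ /= !vwE -addrA; congr (_ + _).
  rewrite -scalerDl -[in RHS](opprK a) [RHS]scalerN -[RHS]scaleNr; congr (_ *: _).
  set p : K := l _; set q : K := w l _; rewrite -[LHS]/(p + (q + p * - 2)) /d -/p -/q; ring.
have tau_root l : is_root l -> is_root (tau l).
  move=> lr; apply: (weyl_root Wv); apply: (rs_refl rsys war).
  exact: (weyl_root Ww (rs_refl rsys ar lr)).
have dD l : is_root l -> d l = 0.
  move=> lr; suff : d l *: a = 0.
    by move=> /eqP; rewrite scaler_eq0 (negPf (root_neq0 ar)) orbF => /eqP.
  apply: (@root_line_finite _ l) => k; elim: k => [|k IH]; first by rewrite addr0.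
  have := tau_root _ IH; rewrite tauE.
  suff -> : d (l + (d l *: a) *+ k) = d l by rewrite -addrA -mulrSr.
  rewrite /d -scaler_nat scalerA !linearD !linearZ /= !add_lfunE !scale_lfunE.
  rewrite (rs_coroot rsys ar) (rs_coroot rsys war).
  have E (x y z : K) : x + z - (y + z) = x - y by ring.
  exact: E.
have dPi j : (tnth Pi j) (coroot a) = w (tnth Pi j) (coroot (w a)) :> K.
  exact: subr0_eq (dD _ (simple_root (mem_tnth j Pi))).
have d0 l : l (coroot a) = w l (coroot (w a)) :> K.
  rewrite (coord_expand Pib l) linear_sum !sum_lfunE; apply: eq_bigr => j _.
  by rewrite linearZ /= !scale_lfunE dPi.
apply/lfunP => l; rewrite !comp_lfunE !reflE linearB linearZ /=.
by rewrite d0.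
Qed.

(** Conjugating [s_a] by itself gives [s_(-a)], with no comparison of the chosen coroots of [a] and
    [-a]. *)
Lemma refl_opp a : is_root a -> refl (- a) = refl a.
Proof.
move=> ar; have := weyl_conj (weyl_refl ar) ar; rewrite (refl_self ar).
move=> /(congr1 (fun f => f \o refl a)%VF).
by rewrite -!comp_lfunA (reflK ar) !comp_lfun1r.
Qed.

Lemma simple_group_weyl w : refl_group simple w -> W w.
Proof. by move=> [s sPi ->]; exists s => // a /sPi; apply: simple_root. Qed.

(** Induction on the height: a simple [b] with [a (coroot b) > 0] makes [s_b a] lower than [a], and
    [s_a = s_b s_(s_b a) s_b]. *)
Lemma refl_simple_group a : is_root a -> refl_group simple (refl a).
Proof.
move=> ar; wlog ap : a ar / pos a.
  move=> wl; have [ap|ap] := pos_or_neg ar; first exact: wl ap.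
  by rewrite -(refl_opp ar); exact: wl (pos_root ap) ap.
have [k] : exists k : nat, height a = k.+1%:R by exact: height_pos.
elim/ltn_ind: k a ap {ar} => k IH a ap ak.
have [aPi|aPi] := boolP (a \in Pi); first exact: refl_group_refl.
have [b [bPi _ ab]] := acute_simple ap.
have br := simple_root bPi; have ar := pos_root ap.
have ba : a != b by apply: contraNneq aPi => ->.
have rp := simple_refl_pos bPi ap ba; have [k' k'E] := height_pos rp.
have kk' : (k' < k)%N.
  have [z zE] := rs_int rsys br ar.
  move: k'E; rewrite reflE heightD heightN heightZ (height_simple bPi) mulr1 ak zE.
  rewrite zE ltr0z in ab; rewrite !pmulrn -intrB => /intr_inj; lia.
have gb := refl_group_refl (bPi : [set` Pi] b).
have := weyl_conj (weyl_refl br) ar => /(congr1 (fun f => refl b \o f)%VF).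
rewrite !comp_lfunA (reflK br) comp_lfun1l => ->.
by do 2?[apply: refl_groupM] => //; exact: (IH _ kk' _ rp k'E).
Qed.

Lemma weyl_simple_group w : W w -> refl_group simple w.
Proof.
move: w; apply: refl_group_ind => [|a w ar _ IH]; first exact: refl_group1.
by apply: refl_groupM => //; exact: refl_simple_group.
Qed.

Lemma weyl_pos_or_neg w a : W w -> is_root a -> pos (w a) \/ pos (- w a).
Proof. by move=> Ww ar; apply: pos_or_neg; exact: weyl_root. Qed.

(** Read from the right, the word turns the image of [a] negative at some letter [b], and this image
    must be [b] itself just before, since [s_b] preserves the positivity of the others. If [u] is
    the part to the right of [b], then [s_b u = u s_a]: the letter [b] is traded for a final
    [s_a]. *)
Lemma exchange s a : {in s, forall b, b \in Pi} -> a \in Pi ->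
  pos (- refl_prod s a) ->
  exists s', [/\ (size s' < size s)%N, {in s', forall b, b \in Pi} &
    refl_prod s = (refl_prod s' \o refl a)%VF].
Proof.
move=> sPi aPi; have ar := simple_root aPi.
elim: s sPi => [_|b s IH sPi].
  rewrite /refl_prod big_nil id_lfunE => neg.
  by case: (pos_neg_false (simple_pos aPi)).
have sPi' : {in s, forall c, c \in Pi} by move=> c cs; apply: sPi; rewrite inE cs orbT.
have bPi : b \in Pi by apply: sPi; rewrite inE eqxx.
have Ws : W (refl_prod s) by apply: simple_group_weyl; exists s.
have sar := weyl_root Ws ar.
have br := simple_root bPi.
rewrite refl_prod_cons comp_lfunE => neg.
have [sap|/(IH sPi')[s' [ss' s'Pi ->]]] := pos_or_neg sar; last first.
  exists (b :: s'); split=> //; last by rewrite refl_prod_cons comp_lfunA.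
  by move=> c; rewrite inE => /orP[/eqP ->//|/s'Pi].
have [sab|sab] := eqVneq (refl_prod s a) b; last first.
  by case: (pos_neg_false (simple_refl_pos bPi sap sab)).
by exists s; split=> //; rewrite (weyl_conj Ws ar) sab.
Qed.

(** If a word for [w] ends in [a], then [w a > 0] says that the rest of the word makes [a] negative.
    Exchange rewrites that rest as a shorter word followed by [s_a]; the two [s_a] cancel and the
    word shrinks. *)
Lemma weyl_pos_id w : W w -> (forall a, a \in Pi -> pos (w a)) -> w = \1%VF.
Proof.
move=> /weyl_simple_group[s]; have [k] := ubnP (size s).
elim: k => // k IH in s w *; case/lastP: s => [_ _ -> _|s a].
  by rewrite /refl_prod big_nil.
rewrite size_rcons ltnS => sk sPi; rewrite -cats1 refl_prod_cat refl_prod1 => wE wPi.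
have aPi : a \in Pi by apply: sPi; rewrite mem_rcons inE eqxx.
have sPi' : {in s, forall c, c \in Pi}.
  by move=> c cs; apply: sPi; rewrite mem_rcons inE cs orbT.
have ar := simple_root aPi.
have := wPi _ aPi; rewrite wE comp_lfunE (refl_self ar) linearN.
move=> /(exchange sPi' aPi)[s' [ss' s'Pi sE]].
have {}wE : w = refl_prod s'.
  by rewrite wE sE -comp_lfunA (reflK ar) comp_lfun1r.
rewrite sE -comp_lfunA (reflK ar) comp_lfun1r -wE.
exact: (IH s' w (ltn_trans ss' sk) s'Pi wE wPi).
Qed.

(** * Inversions and the length function *)

Section Inversions.
Context (rs : seq (dual_space t)) (rsE : forall a, is_root a = (a \in rs)).

Definition inversion_seq w := [seq b <- undup rs | `[< inversions Pi w b >]].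

Lemma mem_inversion_seq w b : reflect (inversions Pi w b) (b \in inversion_seq w).
Proof.
rewrite mem_filter mem_undup -rsE; apply: (iffP andP) => [[/asboolP//]|wb].
by split; [apply/asboolP|exact: pos_root wb.1].
Qed.

(** [s_a] maps the inversions of [w s_a] bijectively onto those of [w] other than [a]. *)
Lemma size_inversions_refl w a : W w -> a \in Pi -> pos (- w a) ->
  size (inversion_seq w) = (size (inversion_seq (w \o refl a)%VF)).+1.
Proof.
move=> Ww aPi wa; have ar := simple_root aPi.
have reflK' b : refl a (refl a b) = b by rewrite -comp_lfunE (reflK ar) id_lfunE.
have ua : a \notin [seq refl a b | b <- inversion_seq (w \o refl a)%VF].
  apply/mapP => -[b /mem_inversion_seq[bp _] aE].
  apply: (pos_neg_false (simple_pos aPi)).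
  by rewrite -(refl_self ar) {2}aE reflK'.
have ui s : uniq [seq refl a b | b <- s] = uniq s.
  by apply: map_inj_uniq => b c /(congr1 (refl a)); rewrite !reflK'.
have -> : size (inversion_seq w) =
    size (a :: [seq refl a b | b <- inversion_seq (w \o refl a)%VF]).
  apply/perm_size/uniq_perm.
  - by rewrite filter_uniq ?undup_uniq.
  - by rewrite /= ua ui filter_uniq ?undup_uniq.
  move=> b; rewrite inE; apply/mem_inversion_seq/orP => [[bp wb]|].
    have [//|ba] := eqVneq b a; [by left|right].
    apply/mapP; exists (refl a b); last by rewrite reflK'.
    apply/mem_inversion_seq; split; first exact: simple_refl_pos.
    by rewrite comp_lfunE reflK'.
  case=> [/eqP ->|/mapP[c /mem_inversion_seq[cp wc] ->]].
    by split=> //; exact: simple_pos.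
  have ca : c != a.
    apply/eqP => ca; apply: (pos_neg_false wa).
    by move: wc; rewrite ca comp_lfunE (refl_self ar) linearN.
  by split; [exact: simple_refl_pos|rewrite -comp_lfunE].
by rewrite /= size_map.
Qed.

Lemma size_inversions_leq s : {in s, forall a, a \in Pi} ->
  (size (inversion_seq (refl_prod s)) <= size s)%N.
Proof.
elim/last_ind: s => [_|s a IH sPi].
  rewrite leqn0 size_eq0; apply/eqP; case E : inversion_seq => [//|b r].
  have /mem_inversion_seq[] : b \in inversion_seq (refl_prod [::]).
    by rewrite E inE eqxx.
  by rewrite /refl_prod big_nil id_lfunE => /pos_neg_false.
have aPi : a \in Pi by apply: sPi; rewrite mem_rcons inE eqxx.
have sPi' : {in s, forall c, c \in Pi}.
  by move=> c cs; apply: sPi; rewrite mem_rcons inE cs orbT.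
have Ws : W (refl_prod s) by apply: simple_group_weyl; exists s.
have ar := simple_root aPi.
rewrite size_rcons -cats1 refl_prod_cat refl_prod1.
have {}IH := IH sPi'.
have [sp|sn] := weyl_pos_or_neg Ws ar; last first.
  apply: leq_trans (leqW IH); rewrite (size_inversions_refl Ws aPi sn).
  exact: leqnSn.
have Wsa : W (refl_prod s \o refl a)%VF by apply: refl_groupM => //; exact: weyl_refl.
rewrite (size_inversions_refl Wsa aPi).
  by rewrite -comp_lfunA (reflK ar) comp_lfun1r ltnS.
by rewrite comp_lfunE (refl_self ar) linearN opprK.
Qed.

(** Stripping off simple inversions one at a time ends at the identity; by [size_inversions_leq],
    the word so obtained has minimal length. *)
Lemma inversion_word w : W w -> exists s,
  [/\ size s = size (inversion_seq w), {in s, forall a, a \in Pi} & w = refl_prod s].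
Proof.
have [k] := ubnP (size (inversion_seq w)); elim: k w => // k IH w wk Ww.
have [[a [aPi wa]]|H] := pselect (exists a, a \in Pi /\ pos (- w a)); last first.
  have w1 : w = \1%VF.
    apply: weyl_pos_id => // a aPi.
    have [//|wa] := weyl_pos_or_neg Ww (simple_root aPi).
    by case: H; exists a.
  have w0 : w = refl_prod [::] by rewrite w1 /refl_prod big_nil.
  exists [::]; split=> //; apply/esym/eqP; rewrite -leqn0 w0.
  exact: (@size_inversions_leq [::]).
have ar := simple_root aPi.
have E := size_inversions_refl Ww aPi wa.
have [||s [ss sPi sE]] := IH (w \o refl a)%VF.
- by rewrite -ltnS -E.
- by apply: refl_groupM => //; exact: weyl_refl.
exists (rcons s a); split.
- by rewrite size_rcons ss E.
- by move=> b; rewrite mem_rcons inE => /orP[/eqP ->//|/sPi].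
by rewrite -cats1 refl_prod_cat refl_prod1 -sE -comp_lfunA (reflK ar) comp_lfun1r.
Qed.

Lemma length_inversions w : W w -> length Pi w = size (inversion_seq w).
Proof.
move=> Ww; have [s [ss sPi sE]] := inversion_word Ww.
have lw : is_length [set` Pi] w (size (inversion_seq w)).
  by split=> [|s' s'Pi ->]; [exists s|exact: size_inversions_leq].
rewrite /length; case: xgetP => [_ -> [[s' [<- s'Pi s'E]] min']|/(_ _ lw)//].
apply/eqP; rewrite eqn_leq; apply/andP; split; last by rewrite s'E size_inversions_leq.
by rewrite -ss min'.
Qed.

End Inversions.

(** * Minimal coset representatives in the abelian case *)

Section AbelianGrading.
Context (i : 'I_n) (theta : dual_space t).
Context (thetaP : highest_root Pi theta) (theta1 : coord Pi i theta = 1).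

Local Notation D0 := (graded_roots Pi i 0).
Local Notation D1 := (graded_roots Pi i 1).
Local Notation le := (root_le Pi i).
Local Notation Wmin := (min_coset_reps Pi i).
Local Notation N := (inversions Pi).

Lemma root_leE a b : le a b <-> nneg_comb Pi (b - a) /\ coord Pi i (b - a) = 0.
Proof.
split=> [[k kE]|[/nneg_combE/choice[k kE] i0]]; last first.
  exists k; rewrite {1}(coord_expand Pib (b - a)) (bigD1 i)//= i0 scale0r add0r.
  by apply: eq_bigr => j _; rewrite kE scaler_nat.
have bE : b - a = \sum_j tnth Pi j *+ (if j == i then 0 else k j)%N.
  rewrite [RHS](bigD1 i)//= eqxx mulr0n add0r kE.
  by apply: eq_bigr => j /negPf ->.
split; first by exists (fun j => (if j == i then 0 else k j)%N).
rewrite bE linear_sum big1// => j _; rewrite -scaler_nat linearZ /= (coord_tnth Pib).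
by rewrite eq_sym; case: eqP => _; rewrite ?mul0r ?mulr0.
Qed.

Lemma root_le_refl a : le a a.
Proof. by apply/root_leE; rewrite subrr linear0; split=> //; exact: nneg_comb0. Qed.

Lemma root_le_trans a b c : le a b -> le b c -> le a c.
Proof.
move=> /root_leE[ab abi] /root_leE[bc bci]; apply/root_leE.
rewrite -(subrK b c) -addrA; split; first exact: nneg_combD.
by rewrite linearD /= bci abi addr0.
Qed.

Lemma nneg_comb_height0 a : nneg_comb Pi a -> height a = 0 -> a = 0.
Proof.
move=> an /eqP; rewrite /height psumr_eq0 => [/allP a0|j _]; last exact: (nneg_coord an).
apply: (coord_inj Pib) => j; rewrite linear0; apply/eqP.
by have := a0 j; rewrite mem_index_enum => /(_ isT).
Qed.

Lemma root_le_height a b : le a b -> a <> b ->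
  exists k : nat, height b = height a + k.+1%:R.
Proof.
move=> /root_leE[ab _] aNb; have [[|k] kE] := height_nneg ab; last first.
  by exists k; rewrite -kE -heightD addrC subrK.
by case: aNb; apply/esym/eqP; rewrite -subr_eq0 (nneg_comb_height0 ab kE).
Qed.

Lemma root_le_anti a b : le a b -> le b a -> a = b.
Proof.
move=> ab ba; apply: contrapT => aNb; have [k kE] := root_le_height ab aNb.
have [k' kE'] := root_le_height ba (fun e => aNb (esym e)).
move/eqP: kE'; rewrite kE -addrA -subr_eq0 opprD addNKr oppr_eq0 -natrD pnatr_eq0.
by rewrite addSn.
Qed.

(** [theta - a] has a nonnegative coefficient [k] at [alpha_i], so the coefficient [m] of a positive
    root satisfies [m + k = 1]. Negative roots are treated through [theta + a]. *)
Lemma graded_cases a : is_root a -> [\/ D0 a, D1 a | D1 (- a)].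
Proof.
move=> ar; have nar := rs_opp rsys ar; have [_ H] := thetaP.
have /nneg_combE/(_ i)[k] := H _ ar; have /nneg_combE/(_ i)[k'] := H _ nar.
rewrite opprK linearD linearB /= theta1 => k'E kE.
have [[_ /nneg_combE/(_ i)[m mE]]|[_ /nneg_combE/(_ i)[m mE]]] := pos_or_neg ar.
  have : (m + k)%:R = 1 :> K by rewrite natrD -kE mE addrC subrK.
  move=> /eqP; rewrite (eqr_nat K _ 1).
  case: m mE => [|[|m]] mE; [constructor 1|constructor 2|lia].
    by split; [exact: ar|exact: mE].
  by split; [exact: ar|exact: mE].
have : (m + k')%:R = 1 :> K by rewrite natrD -k'E -mE linearN addrC addrK.
move=> /eqP; rewrite (eqr_nat K _ 1).
case: m mE => [|[|m]] mE; [constructor 1|constructor 3|lia].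
  by split; [exact: ar|rewrite -[a]opprK linearN /= mE oppr0].
by split; [exact: nar|exact: mE].
Qed.

Lemma D1_root a : D1 a -> is_root a. Proof. by case. Qed.

Lemma D0_root a : D0 a -> is_root a. Proof. by case. Qed.

Lemma D0_opp a : D0 a -> D0 (- a).
Proof.
by move=> [ar a0]; split; [exact: (rs_opp rsys ar)|rewrite linearN /= a0 oppr0].
Qed.

Lemma D1_pos a : D1 a -> pos a.
Proof. by move=> [ar a1]; apply: (coord_gt0_pos ar (j := i)); rewrite a1 ltr01. Qed.

(** With coefficients among -1, 0, 1, the total 1 can only be [0 + 1]: the partner of -1 would have
    coefficient 2. *)
Lemma D1_split_coord a b : is_root a -> is_root b -> D1 (a + b) ->
  (D0 a /\ D1 b) \/ (D1 a /\ D0 b).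
Proof.
move=> ar br [_ ab1]; rewrite linearD /= in ab1.
have [a0|a1|a1] := graded_cases ar.
- by left; split=> //; split; [exact: br|rewrite -ab1 a0.2 add0r].
- right; split=> //; split; first exact: br.
  by apply: (addrI (coord Pi i a)); rewrite ab1 a1.2 addr0.
have bE : coord Pi i b = 2.
  have := a1.2; rewrite linearN => aE; rewrite -[LHS](addKr (coord Pi i a)) ab1.
  by rewrite [- _]aE.
by have [b0|b1|b1] := graded_cases br; [have := b0.2|have := b1.2|have := b1.2];
  rewrite ?linearN /= bE => /eqP; rewrite -?(rmorphN intr) ?(eqr_int K 2) ?(eqr_int K (-2)).
Qed.

Lemma D0_pos_le a b : D0 a -> pos a -> le b (b + a).
Proof. by move=> [_ a0] [_ an]; apply/root_leE; rewrite addrC addKr. Qed.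

(** * Action of minimal representatives on [Delta(1)] *)

Lemma min_rep_weyl w : Wmin w -> W w. Proof. by case. Qed.

Lemma min_rep_D0_pos w a : Wmin w -> D0 a -> pos (w a) -> pos a.
Proof.
move=> [_ wP] a0 wa; have [//|na] := pos_or_neg (D0_root a0).
case: (pos_neg_false wa); rewrite -linearN; apply: wP.
by split; [exact: D0_opp|exact: na].
Qed.

Lemma min_rep_D0_neg w a : Wmin w -> D0 a -> pos (- w a) -> pos (- a).
Proof.
move=> wm a0 wa; apply: (min_rep_D0_pos wm (D0_opp a0)).
by rewrite linearN.
Qed.

(** [b - a] is a combination of [Pi(0)], which [w] sends to positive roots; so [w] turns the order
    of [Delta(1)] into the root order. *)
Lemma min_rep_le w a b : Wmin w -> le a b -> nneg_comb Pi (w b - w a).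
Proof.
move=> [Ww wP] [k kE]; rewrite -linearB kE linear_sum.
elim/big_ind: _ => [|x y xn yn|j ji]; [exact: nneg_comb0|exact: nneg_combD|].
rewrite linearMn; apply: nneg_combMn; suff [] : pos (w (tnth Pi j)) by [].
have jPi := mem_tnth j Pi; apply: wP; split; last exact: simple_pos.
split; first exact: simple_root.
by rewrite (coord_tnth Pib) eq_sym (negPf ji).
Qed.

Lemma upper_coset w c : Wmin w -> (D1 `\` N w) c <-> D1 c /\ pos (w c).
Proof.
move=> wm; split=> [[c1 Nc]|[c1 wc]]; split=> //; last first.
  by case=> _; apply: pos_neg_false.
have [//|wc] := weyl_pos_or_neg (min_rep_weyl wm) (D1_root c1).
by case: Nc; split=> //; exact: D1_pos.
Qed.

Lemma inversions_D1 w c : Wmin w -> N w c <-> D1 c /\ pos (- w c).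
Proof.
move=> wm; split=> [[cp wc]|[c1 wc]]; last by split=> //; exact: D1_pos.
split=> //; have [c0|//|c1] := graded_cases (pos_root cp).
  by case: (pos_neg_false cp); exact: (min_rep_D0_neg wm c0 wc).
by case: (pos_neg_false cp); exact: D1_pos.
Qed.

Lemma min_rep_upper_ideal w : Wmin w -> upper_ideal le D1 (D1 `\` N w).
Proof.
move=> wm; split=> [c []//|x y /(upper_coset _ wm)[x1 wx] y1 xy].
apply/(upper_coset _ wm); split=> //; split.
  exact: (weyl_root (min_rep_weyl wm) (D1_root y1)).
by rewrite -(subrK (w x) (w y)); apply: nneg_combD; [exact: min_rep_le|exact: wx.2].
Qed.

Lemma split_above w c a b : Wmin w -> D1 c -> w c = a + b -> pos a -> pos b ->
  exists d, [/\ D1 d, pos (w d), le d c & d <> c].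
Proof.
move=> wm c1 wc ap bp; have [v [Wv vw wv]] := weyl_inv (min_rep_weyl wm).
have wvE l : w (v l) = l by rewrite -comp_lfunE wv id_lfunE.
have vwE l : v (w l) = l by rewrite -comp_lfunE vw id_lfunE.
have cE : c = v a + v b by rewrite -linearD -wc; exact/esym/vwE.
have var := weyl_root Wv (pos_root ap); have vbr := weyl_root Wv (pos_root bp).
have sub x y : D0 x -> D1 y -> c = x + y -> pos (w x) -> pos (w y) ->
    exists d, [/\ D1 d, pos (w d), le d c & d <> c].
  move=> x0 y1 xy wx wy; exists y; split=> //.
    by rewrite xy addrC; apply: (D0_pos_le _ x0); exact: (min_rep_D0_pos wm x0).
  move=> yc; have /eqP[] := root_neq0 (D0_root x0).
  by apply: (addIr y); rewrite -xy add0r yc.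
have := c1; rewrite cE => /(D1_split_coord var vbr)[[a0 b1]|[a1 b0]].
  by rewrite -cE; apply: (sub _ _ a0 b1 cE); rewrite wvE.
by rewrite -cE; apply: (sub _ _ b0 a1 _); rewrite ?wvE// addrC.
Qed.

(** The signs of [split_above] are reversed: the summand of [c] in [Delta(0)] is now a negative
    root, so the other one lies above [c]. *)
Lemma split_below w c a b : Wmin w -> D1 c -> - w c = a + b -> pos a -> pos b ->
  exists d, [/\ D1 d, pos (- w d), le c d & d <> c].
Proof.
move=> wm c1 wc ap bp; have [v [Wv vw wv]] := weyl_inv (min_rep_weyl wm).
have wvE l : w (v l) = l by rewrite -comp_lfunE wv id_lfunE.
have vwE l : v (w l) = l by rewrite -comp_lfunE vw id_lfunE.
have cE : c = v (- a) + v (- b).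
  by rewrite -linearD -opprD -wc opprK; exact/esym/vwE.
have var := weyl_root Wv (rs_opp rsys (pos_root ap)).
have vbr := weyl_root Wv (rs_opp rsys (pos_root bp)).
have sub x y : D0 x -> D1 y -> c = x + y -> pos (- w x) -> pos (- w y) ->
    exists d, [/\ D1 d, pos (- w d), le c d & d <> c].
  move=> x0 y1 xy wx wy; exists y; split=> //.
    have -> : y = c + - x by rewrite xy addrC addKr.
    by apply: (D0_pos_le _ (D0_opp x0)); exact: (min_rep_D0_neg wm x0).
  move=> yc; have /eqP[] := root_neq0 (D0_root x0).
  by apply: (addIr y); rewrite -xy add0r yc.
have := c1; rewrite cE => /(D1_split_coord var vbr)[[a0 b1]|[a1 b0]].
  by rewrite -cE; apply: (sub _ _ a0 b1 cE); rewrite wvE opprK.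
by rewrite -cE; apply: (sub _ _ b0 a1 _); rewrite ?wvE ?opprK// addrC.
Qed.

Lemma simple_sub_nneg a b : a \in Pi -> pos b -> nneg_comb Pi (a - b) -> b = a.
Proof.
move=> aPi bp ab; apply/esym/eqP; rewrite -subr_eq0; apply/eqP.
apply: (nneg_comb_height0 ab); rewrite heightD heightN (height_simple aPi).
have [k kE] := height_pos bp; have [k' k'E] := height_nneg ab.
move: k'E; rewrite heightD heightN (height_simple aPi) kE => /eqP.
rewrite subr_eq -natrD (eqr_nat K 1) => /eqP kk'; have -> : k = 0%N by lia.
by rewrite subrr.
Qed.

Lemma minimal_simple w c : Wmin w -> (D1 `\` N w) c ->
  minimal le (D1 `\` N w) c <-> w c \in Pi.
Proof.
move=> wm Ic; have [c1 wc] := (upper_coset c wm).1 Ic; split=> [[_ cmin]|wcPi].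
  apply: contrapT => /negP wcPi; have [b bPi wcb] := pos_sub_simple wc wcPi.
  have [] := split_above wm c1 (esym (subrK b (w c))) wcb (simple_pos bPi).
  move=> d [d1 wd dc dNc]; apply: dNc; apply: cmin => //.
  exact/(upper_coset d wm).
(* [w d] is a positive root and [w c - w d] a nonnegative combination, so the simple root [w c] must
   equal [w d]. *)
split=> // d /(upper_coset d wm)[d1 wd] dc.
apply: (weyl_inj (min_rep_weyl wm)); apply: simple_sub_nneg wcPi wd _.
exact: min_rep_le.
Qed.

Lemma maximal_simple w c : Wmin w -> N w c -> maximal le (N w) c <-> - w c \in Pi.
Proof.
move=> wm Nc; have [c1 wc] := (inversions_D1 c wm).1 Nc; split=> [[_ cmax]|wcPi].
  apply: contrapT => /negP wcPi; have [b bPi wcb] := pos_sub_simple wc wcPi.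
  have [] := split_below wm c1 (esym (subrK b (- w c))) wcb (simple_pos bPi).
  move=> d [d1 wd dc dNc]; apply: dNc; apply: cmax => //.
  exact/(inversions_D1 d wm).
split=> // d /(inversions_D1 d wm)[d1 wd] cd.
apply: (weyl_inj (min_rep_weyl wm)); apply: oppr_inj; apply: simple_sub_nneg wcPi wd _.
by rewrite opprK addrC; exact: min_rep_le.
Qed.

(** * Lower ideals as inversion sets *)

Lemma simple_D0 j : j != i -> D0 (tnth Pi j) /\ pos (tnth Pi j).
Proof.
move=> ji; have jPi := mem_tnth j Pi; split; last exact: simple_pos.
split; first exact: simple_root.
by rewrite (coord_tnth Pib) eq_sym (negPf ji).
Qed.

Lemma D0_D1_false a : D0 a -> D1 a -> False.
Proof. by move=> [_ a0] [_]; rewrite a0 => /eqP; rewrite (eqr_int K 0 1). Qed.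

Lemma min_rep1 : Wmin \1%VF.
Proof. by split=> [|a [_ ap]]; [exact: refl_group1|rewrite id_lfunE]. Qed.

Lemma above_minimal M c : M `<=` D1 -> M c -> exists2 d, minimal le M d & le d c.
Proof.
move=> M1 Mc; have [k ck] := height_nneg (D1_pos (M1 _ Mc)).2.
have [||k' x y Mx My yx yNx xk|d [dmin dc]] := @ex_minimal_rank _ le
    (fun k x => height x = k%:R) M _ _ _ k c Mc ck.
- exact: root_le_refl.
- by move=> *; apply: root_le_trans; eassumption.
- have [m] := root_le_height yx yNx; rewrite xk => kE.
  have [q yq] := height_nneg (D1_pos (M1 _ My)).2; exists q => //.
  by move/eqP: kE; rewrite yq -natrD eqr_nat => /eqP; lia.
by exists d.
Qed.

(** The rank is [height theta - height x], a natural number because [theta] is highest. *)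
Lemma below_maximal M c : M `<=` D1 -> M c -> exists2 d, maximal le M d & le c d.
Proof.
move=> M1 Mc; have [_ H] := thetaP.
have rank x : D1 x -> exists k : nat, height theta - height x = k%:R.
  by move=> /D1_root/H/height_nneg; rewrite heightD heightN.
have [k ck] := rank _ (M1 _ Mc).
have [||k' x y Mx My xy yNx xk|d [dmin cd]] := @ex_minimal_rank _ (fun x y => le y x)
    (fun k x => height theta - height x = k%:R) M _ _ _ k c Mc ck.
- exact: root_le_refl.
- by move=> *; apply: root_le_trans; eassumption.
- have [m yE] := root_le_height xy (fun e => yNx (esym e)).
  have [q yq] := rank _ (M1 _ My); exists q => //.
  move: yq; rewrite yE opprD addrA xk => /eqP; rewrite subr_eq -natrD eqr_nat => /eqP.
  lia.
by exists d.
Qed.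

Lemma lower_ideal_inversions M : M `<=` D1 ->
  (forall x y, M x -> D1 y -> le y x -> M y) ->
  exists2 w, Wmin w & forall c, N w c <-> M c.
Proof.
have [rs rsE] := rs_finite rsys.
pose els M := [seq c <- undup rs | `[< M c >]].
have [k] := ubnP (size (els M)); elim: k M => // k IH M Mk M1 Mlow.
have [[x Mx]|M0] := pselect (exists x, M x); last first.
  exists \1%VF; first exact: min_rep1.
  move=> c; split=> [[cp]|Mc]; last by case: M0; exists c.
  by rewrite id_lfunE => /(pos_neg_false cp).
have [z [Mz zmax] _] := below_maximal M1 Mx.
pose M' := M `\` [set z].
have [|||w wm wE] := IH M'.
- rewrite -ltnS; apply: leq_trans _ Mk; rewrite ltnS.
  apply: (@uniq_leq_size _ (z :: els M')) => [|c].
    rewrite /= filter_uniq ?undup_uniq// andbT mem_filter.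
    by apply/nandP; left; apply/asboolP => -[_ /(_ erefl)].
  rewrite inE => /orP[/eqP ->|].
    rewrite mem_filter mem_undup -rsE (D1_root (M1 _ Mz)) andbT.
    exact/asboolP.
  by rewrite !mem_filter => /andP[/asboolP[Mc _] ->]; rewrite andbT; apply/asboolP.
- by move=> c [/M1].
- move=> c d [Mc cz] d1 dc; split; first exact: Mlow Mc d1 dc.
  by move=> /= dz; apply: cz; rewrite /= -dz in zmax *; apply: zmax.
have Iz : (D1 `\` N w) z by split; [exact: M1|move=> /wE[_]; apply].
(* Anything of [Delta(1)] below [z] lies in [M], hence in [N w] unless it equals [z]; so [z] is
   minimal outside [N w]. *)
have zPi : w z \in Pi.
  apply/(minimal_simple wm Iz); split=> // y [y1 Ny] yz; apply: contrapT => yNz.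
  by apply: Ny; apply/wE; split=> //; exact: Mlow Mz y1 yz.
have zr := simple_root zPi; have Ww := min_rep_weyl wm.
have z1 := M1 _ Mz.
have wm' : Wmin (refl (w z) \o w)%VF.
  split=> [|a [a0 ap]].
    by apply: refl_groupM => //; exact: weyl_refl.
  have wap : pos (w a) by apply: wm.2.
  (* The only positive root made negative by the new reflection is [w z], and [z] has degree 1 while
     [a] has degree 0. *)
  rewrite comp_lfunE; apply: (simple_refl_pos zPi wap).
  by apply/eqP => /(weyl_inj Ww) az; apply: (D0_D1_false a0); rewrite az.
exists (refl (w z) \o w)%VF; first exact: wm'.
move=> c; split=> [Nc|Mc].
  have [c1 wc] := (inversions_D1 c wm').1 Nc; apply: contrapT => Mc.
  have wcp : pos (w c).
    have [//|wc'] := weyl_pos_or_neg Ww (D1_root c1); case: Mc.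
    by have /wE[] : N w c by apply/(inversions_D1 _ wm).
  have cz : w c != w z by apply/eqP => /(weyl_inj Ww) cz; apply: Mc; rewrite cz.
  by case: (pos_neg_false (simple_refl_pos zPi wcp cz)); rewrite -comp_lfunE.
apply/(inversions_D1 _ wm'); split; first exact: M1.
have [->|/eqP cz] := eqVneq c z.
  by rewrite comp_lfunE (refl_self zr) opprK; exact: simple_pos.
have /(inversions_D1 _ wm)[c1 wc] : N w c by apply/wE.
(* [- w c] is positive and differs from [w z], as [z] is positive and [- c] is not; so it stays
   positive under the reflection. *)
rewrite comp_lfunE -linearN; apply: (simple_refl_pos zPi wc).
apply/eqP => cE; apply: (pos_neg_false (D1_pos c1)).
suff -> : - c = z by exact: D1_pos.
by apply: (weyl_inj Ww); rewrite linearN.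
Qed.

(** [v u^-1] sends every simple root [a] to a positive root: otherwise [u^-1 a] or its opposite
    would be an inversion of exactly one of [u] and [v]. *)
Lemma inversions_inj u v : W u -> W v -> (forall c, N u c <-> N v c) -> u = v.
Proof.
move=> Wu Wv uv; have [u' [Wu' u'u uu']] := weyl_inv Wu.
have uu'E l : u (u' l) = l by rewrite -comp_lfunE uu' id_lfunE.
suff vu' : (v \o u')%VF = \1%VF.
  by rewrite -(comp_lfun1l u) -vu' -comp_lfunA u'u comp_lfun1r.
apply: weyl_pos_id => [|a aPi]; first exact: refl_groupM.
rewrite comp_lfunE; have ap := simple_pos aPi.
have u'ar := weyl_root Wu' (pos_root ap).
have [//|vn] := weyl_pos_or_neg Wv u'ar; case: (pos_neg_false ap).
have [u'p|u'n] := pos_or_neg u'ar.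
  have /uv[_] : N v (u' a) by [].
  by rewrite uu'E.
have /uv[_] : N u (- u' a).
  by split; [exact: u'n|rewrite (linearN u) opprK /= uu'E].
by rewrite (linearN v) opprK => vp; case: (pos_neg_false vp vn).
Qed.

(** An upper ideal is generated by its minimal elements, because descents in [Delta(1)] are bounded
    by the height. *)
Lemma minimal_upper_ideal_inj (M M' : set (dual_space t)) :
  upper_ideal le D1 M -> upper_ideal le D1 M' -> minimal le M = minimal le M' -> M = M'.
Proof.
have sub (P P' : set (dual_space t)) : upper_ideal le D1 P -> upper_ideal le D1 P' ->
    minimal le P = minimal le P' -> P `<=` P'.
  move=> [P1 _] [_ Pup] PP' c Pc; have [d] := above_minimal P1 Pc.
  by rewrite PP' => -[Pd _] dc; apply: Pup Pd (P1 _ Pc) dc.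
by move=> MI MI' MM'; apply/seteqP; split; apply: sub.
Qed.

Lemma coset_inversions w w' : Wmin w -> Wmin w' -> D1 `\` N w = D1 `\` N w' -> w = w'.
Proof.
move=> wm wm' ww'; apply: inversions_inj => [||c]; [exact: min_rep_weyl..|].
have E u : Wmin u -> N u c <-> D1 c /\ ~ (D1 `\` N u) c.
  move=> um; split=> [Nc|[c1 Ic]]; last by apply: contrapT => Nc; apply: Ic.
  by have [c1 _] := (inversions_D1 c um).1 Nc; split=> // -[].
by rewrite (E _ wm) (E _ wm') ww'.
Qed.

Lemma minimal_bij : set_bij Wmin (antichains le D1) (fun w => minimal le (D1 `\` N w)).
Proof.
split.
- move=> w wm; split=> [c [[]]//|x y [Ix _] [Iy ymin] xy].
  exact: ymin.
- move=> w w' /set_mem wm /set_mem wm' ww'; apply: coset_inversions => //.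
  by apply: minimal_upper_ideal_inj ww'; exact: min_rep_upper_ideal.
(* [J] is the upper ideal generated by [A]; its complement in [Delta(1)] is a lower ideal, hence an
   inversion set. *)
move=> A [A1 Aanti]; pose J := [set c | D1 c /\ exists2 a, A a & le a c].
have AJ a : A a -> J a.
  by move=> Aa; split; [exact: A1|exists a => //; exact: root_le_refl].
have [||w wm wE] := @lower_ideal_inversions (D1 `\` J).
- by move=> c [].
- move=> x y [x1 Jx] y1 yx; split=> // -[_ [a Aa ay]]; apply: Jx.
  by split=> //; exists a => //; exact: root_le_trans yx.
have IJ : D1 `\` N w = J.
  apply/seteqP; split=> c; last by move=> Jc; split=> [|/wE[_]//]; case: Jc.
  by move=> [c1 Nc]; apply: contrapT => Jc; apply: Nc; apply/wE.
exists w => //; rewrite IJ; apply/seteqP; split=> [c [[c1 [a Aa ac]] cmin]|a Aa].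
  by rewrite -(cmin _ (AJ _ Aa) ac).
split; first exact: AJ.
move=> c [c1 [a' Aa' a'c]] ca; apply: root_le_anti => //.
by rewrite -(Aanti _ _ Aa' Aa (root_le_trans a'c ca)).
Qed.

Lemma finite_roots (P : set (dual_space t)) : (forall a, P a -> is_root a) -> finite_set P.
Proof.
have [rs rsE] := rs_finite rsys => Pr.
apply: (@finite_subfset _ [fset a in rs]%fset) => a /Pr ar.
by rewrite /= inE -rsE.
Qed.

Lemma finite_antichains : finite_set (antichains le D1).
Proof.
have D1fin : finite_set D1 by apply: finite_roots; exact: D1_root.
apply: (@sub_finite_set _ _
  [set [set` F] | F in [set` fpowerset (fset_set D1)]]); last first.
  by apply: finite_image; exact: finite_fset.
move=> A [A1 _]; have Afin : finite_set A by exact: sub_finite_set A1 D1fin.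
exists (fset_set A); last by rewrite fset_setK.
by rewrite /= fpowersetE -fset_set_sub.
Qed.

(** * Cosets of [W(0)] *)

Local Notation W0 := (weyl_group0 Pi i).

Lemma simple_roots0_simple a : simple_roots0 Pi i a -> a \in Pi.
Proof. by move=> [j _ <-]; exact: mem_tnth. Qed.

Lemma weyl_group0_weyl u : W0 u -> W u.
Proof.
by move=> [s s0 ->]; exists s => // a /s0/simple_roots0_simple; exact: simple_root.
Qed.

Lemma weyl_group0_coord u l : W0 u -> coord Pi i (u l) = coord Pi i l.
Proof.
move=> W0u; move: u W0u l; apply: refl_group_ind => [l|a u [j /= ji <-] _ IH l].
  by rewrite id_lfunE.
rewrite comp_lfunE reflE linearB linearZ /= (coord_tnth Pib) eq_sym (negPf ji).
by rewrite mulr0 subr0 IH.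
Qed.

Lemma weyl_group0_inv u : W0 u -> exists v, [/\ W0 v, (v \o u)%VF = \1%VF & (u \o v)%VF = \1%VF].
Proof.
by apply: refl_group_inv => a /simple_roots0_simple; exact: simple_root.
Qed.

(** [u] keeps every simple root positive. For [alpha_i] this holds since [W(0)] preserves the
    coefficient at [alpha_i]; the other simple roots stay in degree 0, where positivity of [w (u a)]
    forces that of [u a]. *)
Lemma min_rep_coset_unique w u : Wmin w -> W0 u -> Wmin (w \o u)%VF -> u = \1%VF.
Proof.
move=> wm u0 wum; have Wu := weyl_group0_weyl u0.
apply: weyl_pos_id => // a aPi; have uar := weyl_root Wu (simple_root aPi).
have /tnthP[j aE] := aPi; have [ji|ji] := eqVneq j i.
  apply: (coord_gt0_pos uar (j := i)).
  by rewrite (weyl_group0_coord _ u0) aE ji (coord_tnth Pib) eqxx ltr01.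
have [a0 ap] := simple_D0 ji; rewrite -aE in a0 ap.
apply: (min_rep_D0_pos wm); last by rewrite -comp_lfunE; apply: wum.2.
by split; [exact: uar|rewrite (weyl_group0_coord _ u0) a0.2].
Qed.

(** As long as [w] makes some [alpha] in [Pi(0)] negative, passing to [w s_alpha] removes one
    inversion. *)
Lemma min_rep_exists w : W w -> exists2 u, W0 u & Wmin (w \o u)%VF.
Proof.
have [rs rsE] := rs_finite rsys.
have [k] := ubnP (size (inversion_seq rs w)); elim: k w => // k IH w wk Ww.
have [[j [ji wj]]|H] := pselect (exists j, j != i /\ pos (- w (tnth Pi j))).
  have jPi := mem_tnth j Pi; have sj := size_inversions_refl rsE Ww jPi wj.
  have [||u u0 um] := IH (w \o refl (tnth Pi j))%VF.
  - by rewrite -ltnS -sj.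
  - by apply: refl_groupM => //; apply: weyl_refl; exact: simple_root.
  exists (refl (tnth Pi j) \o u)%VF; last by rewrite comp_lfunA.
  by apply: refl_groupM => //; apply: refl_group_refl; exists j.
exists \1%VF; first exact: refl_group1.
rewrite comp_lfun1r; split=> // a [a0 ap].
split; first exact: (weyl_root Ww (pos_root ap)).
(* A root of [Delta(0)^+] expands over [Pi(0)] alone, so the sign of its image is decided on
   [Pi(0)]. *)
have : le 0 a by apply/root_leE; rewrite subr0; split; [exact: ap.2|exact: a0.2].
move=> [c]; rewrite subr0 => ->; rewrite linear_sum.
elim/big_ind: _ => [|x y xn yn|j ji]; [exact: nneg_comb0|exact: nneg_combD|].
rewrite linearMn; apply: nneg_combMn; suff [] : pos (w (tnth Pi j)) by [].
have [//|wj] := weyl_pos_or_neg Ww (simple_root (mem_tnth j Pi)).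
by case: H; exists j.
Qed.

Lemma coset_bij : set_bij Wmin (left_cosets W W0) (fun w => [set (w \o u)%VF | u in W0]).
Proof.
split.
- by move=> w wm; exists w => //; exact: min_rep_weyl.
- move=> w w' /set_mem wm /set_mem wm' ww'.
  have : [set (w \o u)%VF | u in W0] w'.
    by rewrite ww'; exists \1%VF; rewrite ?comp_lfun1r//; exact: refl_group1.
  case=> u u0 uE; rewrite -uE in wm'.
  by rewrite -uE (min_rep_coset_unique wm u0 wm') comp_lfun1r.
move=> _ [w Ww <-]; have [u u0 um] := min_rep_exists Ww.
have [v [v0 vu uv]] := weyl_group0_inv u0.
exists (w \o u)%VF => //; apply/seteqP; split=> _ [x x0 <-].
  by exists (u \o x)%VF; [exact: refl_groupM|rewrite comp_lfunA].
exists (v \o x)%VF; first exact: refl_groupM.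
by rewrite comp_lfunA -(comp_lfunA w) uv comp_lfun1r.
Qed.

Lemma antichains_card : antichains le D1 #= left_cosets W W0.
Proof.
have img T (B : set T) f : set_bij Wmin B f -> B #= Wmin.
  case=> fmap finj fsurj; suff -> : B = f @` Wmin by exact: inj_card_eq.
  by apply/seteqP; split=> [|_ [w wm <-]]; [exact: fsurj|exact: fmap].
apply: card_eq_trans (img _ _ _ minimal_bij) _; rewrite card_eq_sym.
exact: img coset_bij.
Qed.

Lemma inversions_sub w : Wmin w -> N w `<=` D1.
Proof. by move=> wm c /(inversions_D1 c wm)[]. Qed.

Lemma minimal_coset w : Wmin w ->
  minimal le (D1 `\` N w) = (w @^-1` [set` Pi]) `&` D1.
Proof.
move=> wm; apply/seteqP; split=> [c cmin|c [/= wcPi c1]].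
  by split; [exact/(minimal_simple wm cmin.1)|exact: cmin.1.1].
apply/(minimal_simple wm _) => //; apply/(upper_coset c wm); split=> //.
exact: simple_pos.
Qed.

Lemma maximal_inversions w : Wmin w ->
  maximal le (N w) = [set - c | c in w @^-1` [set` Pi]] `&` D1.
Proof.
move=> wm; apply/seteqP; split=> [c cmax|_ [[c /= wcPi <-] c1]].
  split; last exact: (inversions_sub wm cmax.1).
  exists (- c); last by rewrite opprK.
  by rewrite /= linearN; exact/(maximal_simple wm cmax.1).
have wNc : - w (- c) = w c by rewrite linearN opprK.
apply/(maximal_simple wm _); last by rewrite wNc.
apply/(inversions_D1 _ wm); split=> //.
by rewrite wNc; exact: simple_pos.
Qed.

Lemma card_coset w : Wmin w ->
  (#|` fset_set (D1 `\` N w)| + length Pi w)%N = #|` fset_set D1|.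
Proof.
move=> wm; have [rs rsE] := rs_finite rsys.
have D1fin : finite_set D1 by apply: finite_roots; exact: D1_root.
have Nfin : finite_set (N w) by apply: finite_roots => c [/pos_root].
rewrite (length_inversions rsE (min_rep_weyl wm)) fset_setD//.
rewrite -[RHS](cardfsID (fset_set (N w))) addnC; congr (_ + _)%N.
have us : uniq (inversion_seq rs w) by rewrite filter_uniq ?undup_uniq.
apply: perm_size; apply: uniq_perm; rewrite ?fset_uniq// => c.
rewrite in_fsetI !in_fset_set//; apply/(mem_inversion_seq rsE)/andP => [Nc|[_]].
  by split; apply/mem_set => //; exact: inversions_sub Nc.
by move/set_mem.
Qed.

End AbelianGrading.

End RootCombinatorics.

Theorem theorem3p1 (R : realType) (g : lieAlgType R[i]) (t : {vspace g})
    (n : nat) (Pi : n.-tuple (dual_space t)) (theta : dual_space t) (i : 'I_n) :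
  simple_lie g -> cartan_subalgebra t -> is_base Pi ->
  highest_root Pi theta -> coord Pi i theta = 1 ->
  let W := weyl_group t in
  let W0 := weyl_group0 Pi i in
  let Wmin := min_coset_reps Pi i in
  let D1 := graded_roots Pi i 1 in
  let le := root_le Pi i in
  let N := inversions Pi in
  let I := fun w : 'End(dual_space t) => D1 `\` N w in
  let Gamma := fun w : 'End(dual_space t) => minimal le (D1 `\` N w) in
  let AN := antichains le D1 in
  [/\ set_bij Wmin AN Gamma,
      (forall w, Wmin w ->
        [/\ upper_ideal le D1 (I w),
            (forall c, I w c -> minimal le (I w) c <-> w c \in Pi) /\
            (Gamma w = minimal le (I w) /\
             minimal le (I w) = (w @^-1` [set` Pi]) `&` D1),
            (forall c, N w c -> maximal le (N w) c <-> - w c \in Pi) /\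
            (maximal le (N w) = maximal le (D1 `\` I w) /\
             maximal le (D1 `\` I w) =
               [set - c | c in w @^-1` [set` Pi]] `&` D1),
            finite_set (I w) &
            (#|` fset_set (I w)|)%:Z =
              (\dim (graded_part Pi i 1))%:Z - (length Pi w)%:Z]),
      finite_set AN,
      finite_set (left_cosets W W0) &
      AN #= left_cosets W W0].
Proof.
move=> gS tC PiB thetaP theta1 W W0 Wmin D1 le N I Gamma AN.
have rsys := simple_root_axioms gS tC.
have D1fin : finite_set D1 by apply: (finite_roots rsys) => a [].
have ANfin : finite_set AN := finite_antichains Pi rsys i.
have ANcard : AN #= left_cosets W W0 := antichains_card rsys PiB thetaP theta1.
split=> //; first exact: (minimal_bij rsys PiB thetaP theta1).
  move=> w wm; have NE : D1 `\` I w = N w.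
    by rewrite setDD setIidr//; exact: (inversions_sub rsys PiB thetaP theta1 wm).
  rewrite NE; split.
  - exact: (min_rep_upper_ideal rsys PiB wm).
  - split=> [c Ic|]; first exact: (minimal_simple rsys PiB thetaP theta1 wm Ic).
    by split=> //; exact: (minimal_coset rsys PiB thetaP theta1 wm).
  - split=> [c Nc|]; first exact: (maximal_simple rsys PiB thetaP theta1 wm Nc).
    by split=> //; exact: (maximal_inversions rsys PiB thetaP theta1 wm).
  - exact: finite_setD.
  (* The root spaces are lines in direct sum, so [dim g(1)] counts the roots of degree 1. *)
  have -> : \dim (graded_part Pi i 1) = #|` fset_set D1|.
    rewrite /graded_part -/D1 -{1}(fset_setK D1fin) -fsbig_seq ?fset_uniq//.
    apply: (dim_sum_root_spaces gS tC) => [|a]; first exact: fset_uniq.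
    by rewrite in_fset_set// => /set_mem[].
  by rewrite -(card_coset rsys PiB thetaP theta1 wm) PoszD addrK.
by rewrite -(eq_finite_set ANcard).
Qed.
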